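(* Let $n, t \in \mathbf{N}$ and $d \geq 1$, let $q$ be a power of an odd prime, and let $A \subseteq \mathbf{F}_q^d$ with $|A| \geq 12 n^2 q^{\frac{d-1}{2} + t}$. Then $A$ contains an isometric copy of every distance graph with $n$ vertices and maximum vertex degree $t$.
   Context: $\mathbf{F}_q$ denotes the finite field with $q$ elements, of odd characteristic. For $v,w \in \mathbf{F}_q^d$, $v\cdot w = \sum_{j=1}^d v_j w_j$ and $|v|^2 := v\cdot v$; the ''distance'' between $v$ and $w$ is $|v-w|^2 \in \mathbf{F}_q$. A distance graph is a finite simple graph $\mathcal{G}=(V,E)$ together with an assignment of a nonzero length $\lambda_e \in \mathbf{F}_q^* = \mathbf{F}_q\setminus\{0\}$ to each edge $e\in E$. A set $X \subseteq \mathbf{F}_q^d$ is an isometric copy of $\mathcal{G}$ if there is a bijection $\varphi: V \to X$ such that $|\varphi(v)-\varphi(w)|^2 = \lambda_e$ whenever $v,w\in V$ are joined by an edge $e$. ''$A$ contains an isometric copy'' means some $X\subseteq A$ is an isometric copy. *)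

(* Defs.v *)
From HB Require Import structures.
From mathcomp Require Import all_boot all_order all_algebra all_field.
Set Implicit Arguments. Unset Strict Implicit. Unset Printing Implicit Defensive.
Import GRing.Theory.
Local Open Scope ring_scope.

Definition dotv (F : fieldType) (d : nat) (v w : 'rV[F]_d) : F :=
  \sum_(j < d) v 0 j * w 0 j.

Definition sqnorm (F : fieldType) (d : nat) (v : 'rV[F]_d) : F := dotv v v.

Definition distance_graph (F : fieldType) (n : nat)
  (E : rel 'I_n) (lam : 'I_n -> 'I_n -> F) : Prop :=
  [/\ (forall i, ~~ E i i),
      (forall i j, E i j = E j i),
      (forall i j, E i j -> lam i j = lam j i) &
      (forall i j, E i j -> lam i j != 0)].

Definition max_degree_le (n : nat) (E : rel 'I_n) (t : nat) : Prop :=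
  forall i : 'I_n, (#|[set j | E i j]| <= t)%N.

Definition contains_isometric_copy (F : finFieldType) (d n : nat)
  (A : {set 'rV[F]_d}) (E : rel 'I_n) (lam : 'I_n -> 'I_n -> F) : Prop :=
  exists phi : 'I_n -> 'rV[F]_d,
    [/\ injective phi,
        (forall i, phi i \in A) &
        (forall i j, E i j -> sqnorm (phi i - phi j) = lam i j)].

(* Main.v *)
Require Import Defs.
From HB Require Import structures.
From mathcomp Require Import all_fingroup all_solvable all_character.
From mathcomp Require Import all_boot all_order all_algebra all_field.
From mathcomp Require Import zify ring.
Set Implicit Arguments. Unset Strict Implicit. Unset Printing Implicit Defensive.
Import Order.TTheory GRing.Theory Num.Theory.
Local Open Scope ring_scope.

(* The vertices are embedded one at a time, every vertex w still to be placed keeping the set C_w of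
   the points of A at the right distances from the images of its placed neighbours.  When v is
   placed at x, the set C_w of a neighbour w of v shrinks by a factor of about q, unless x belongs
   to a small set of bad points.  That set is small because the number of pairs at distance
   lam != 0 in B x C differs from |B||C|/q by at most 2 q^((d-1)/2) (|B||C|)^(1/2); by Fourier
   analysis on F^d this amounts to bounding by 2 q^(1/2) a Salie sum (d odd), which is explicit,
   or a Kloosterman sum K (d even).

   For K, write K_k(b) for the Kloosterman sums of parameters b and a b over the extension of degree
   k.  Newton's identities for the L-function, a sum over monic polynomials, give
   K_k(b) = - (x_b^k + y_b^k) with x_b + y_b = - K_1(b) and x_b y_b = q.  The sum of the K_k(b)
   over b counts the solutions of z^q - z = r + a / r, that is, the square values of
   (z^q - z)^2 - 4 a, which Stepanov's method evaluates up to O(q^(k/2)).  If some K_1(b)^2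
   exceeded 4 q then x_b or y_b would be real and larger than q^(1/2), a contradiction when k
   tends to infinity. *)

(** * Stepanov's method for hyperelliptic equations *)

(** The constant 12 n^2 comes from the greedy step. Each time a neighbour of w is placed, C_w may
    lose a fraction 1/(2 n) beyond the factor q; at most n such losses leave |C_w| >= |A| / (2 q^r),
    where r neighbours of w are placed. A larger loss at every point of a bad set B is a deviation
    of at least |B||C_w| / (2 n q) in the count of pairs, so |B||C_w| <= 16 n^2 q^(d+1). Two
    adjacent unplaced vertices have at most t - 1 placed neighbours each, so |C_v||C_w| >= 36 n^4
    q^(d+1), and the bad points of C_v for all its neighbours together stay below half of C_v.

    On the Kloosterman side the count of square values is used as a one-sided bound: it bounds the
    sum over b of the x_b^k + y_b^k from above. A single large term is then contradictory only if
    the others cannot cancel it. This is why k = 2 h is even: each x_b^k + y_b^k is then at least -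
    2 q^h a priori. Even degrees also suit Stepanov's method, which works over a field of order P^2
    with P = q^h. *)

Lemma expr_sum_pchar (R : comNzRingType) (I : Type) (r : seq I) (p : pred I)
    (G : I -> R) (P : nat) :
  [pchar R].-nat P -> (\sum_(i <- r | p i) G i) ^+ P = \sum_(i <- r | p i) G i ^+ P.
Proof.
move=> cP; have P0: (0 < P)%N by case/andP: cP.
elim/big_rec2: _ => [|i x y _ <-]; first by rewrite expr0n gtn_eqF.
by rewrite exprDn_pchar.
Qed.

Lemma exprB_pchar (R : comNzRingType) (x y : R) (P : nat) :
  [pchar R].-nat P -> (x - y) ^+ P = x ^+ P - y ^+ P.
Proof.
by move=> cP; apply/(addIr (y ^+ P)); rewrite subrK -exprDn_pchar // subrK.
Qed.

Lemma pchar_nat_poly (R : idomainType) (P : nat) :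
  [pchar R].-nat P -> [pchar {poly R}].-nat P.
Proof. by rewrite (eq_pnat _ (pchar_poly R)). Qed.

Lemma expr_pchar_inj (R : fieldType) (P : nat) :
  [pchar R].-nat P -> injective (fun x : R => x ^+ P).
Proof.
move=> cP x y /= /eqP; rewrite -subr_eq0 -exprB_pchar // expf_eq0 subr_eq0.
by case/andP=> _ /eqP.
Qed.

(** If A and B were nonzero, the multiplicity of [rho] would be odd on the left and even on the
    right. *)
Lemma eq_sqr_mul_mup1 (L : fieldType) (f A B : {poly L}) (c rho : L) :
  f != 0 -> mup rho f = 1%N -> c != 0 -> A ^+ 2 * f = c *: B ^+ 2 -> A = 0 /\ B = 0.
Proof.
move=> f0 mf c0 e.
have [A0|A0] := eqVneq A 0.
  split=> //; move: e; rewrite A0 expr0n mul0r => /esym/eqP.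
  by rewrite scaler_eq0 (negPf c0) expf_eq0 => /eqP.
have [B0|B0] := eqVneq B 0.
  by move: e => /eqP; rewrite B0 expr0n scaler0 mulf_eq0 expf_eq0 (negPf A0) (negPf f0).
have := congr1 (mup rho) e; rewrite -mul_polyC !expr2 !mupM ?mulf_neq0 ?polyC_eq0 //.
by rewrite mf (mupNroot (q := c%:P)) ?rootC //; lia.
Qed.

(** Modulo X^P the relation reads A_0 + B_0 G = 0, while G^2 f = f^P is congruent to the constant
    f(0)^P. Hence A_0^2 f and f(0)^P B_0^2 agree modulo X^P; their sizes are at most P, so they are
    equal, and the simple root of f forces A_0 = B_0 = 0. Then divide by X^P and iterate. *)
Lemma stepanov_nonvanishing (L : fieldType) (P k n : nat) (f G : {poly L}) (rho : L)
    (A B : nat -> {poly L}) :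
  (0 < k)%N -> [pchar L].-nat P -> (2 * k + size f <= P.+2)%N -> f.[0] != 0 -> mup rho f = 1%N ->
  G ^+ 2 * f = f ^+ P ->
  (forall j, (size (A j) <= k)%N /\ (size (B j) <= k)%N) ->
  \sum_(j < n) (A j + B j * G) * 'X^(j * P) = 0 ->
  forall j, (j < n)%N -> A j = 0 /\ B j = 0.
Proof.
move=> k0 cP kP f0 mf eG; elim: n A B => [//|n IHn] A B sAB.
have P0: (0 < P)%N by case/andP: cP.
have fn0: f != 0 by apply: contraNneq f0 => ->; rewrite horner0.
rewrite big_ord_recl /= mul0n expr0 mulr1 => e.
pose A' := \sum_(j < n) A j.+1 * 'X^(j * P).
pose B' := \sum_(j < n) B j.+1 * 'X^(j * P).
have eS: \sum_(i < n) (A (bump 0 i) + B (bump 0 i) * G) * 'X^(bump 0 i * P)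
   = (A' + B' * G) * 'X^P.
  rewrite /A' /B' !mulr_suml -big_split /= mulr_suml; apply: eq_bigr => i _.
  rewrite /bump /= add1n mulSn exprD; ring.
rewrite eS in e.
have [fq efq]: exists fq : {poly L}, f ^+ P = (f.[0] ^+ P)%:P + fq * 'X^P.
  have /factor_theorem[r er]: root (f - f.[0]%:P) 0.
    by rewrite /root !hornerE subrr.
  exists (r ^+ P); apply/(addIr (- f.[0] ^+ P)%:P).
  rewrite polyCN polyC_exp -exprB_pchar ?pchar_nat_poly // er subr0 exprMn; ring.
have c0: f.[0] ^+ P != 0 by rewrite expf_neq0.
have e2: exists W : {poly L}, A 0%N ^+ 2 * f - f.[0] ^+ P *: B 0%N ^+ 2 = W * 'X^P.
  have eA: A 0%N = - (B 0%N * G + (A' + B' * G) * 'X^P).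
    apply/eqP; rewrite -addr_eq0 -[X in _ == X]e; apply/eqP; ring.
  exists ((B 0%N) ^+ 2 * fq + (2%:R * (B 0%N * G) * (A' + B' * G) + (A' + B' * G) ^+ 2 * 'X^P) * f).
  rewrite eA -mul_polyC.
  transitivity (B 0%N ^+ 2 * (G ^+ 2 * f)
    + (2%:R * (B 0%N * G) * (A' + B' * G) + (A' + B' * G) ^+ 2 * 'X^P) * f * 'X^P
    - (f.[0] ^+ P)%:P * B 0%N ^+ 2).
    ring.
  rewrite eG efq; ring.
have [W eW] := e2.
have [sA sB] := sAB 0%N.
have sz (C : {poly L}) : (size C <= k)%N -> (size (C ^+ 2)%R <= (2 * k).-1)%N.
  move=> sC; rewrite expr2; apply: leq_trans (size_polyMleq _ _) _; lia.
have sf0: (0 < size f)%N by rewrite size_poly_gt0.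
have sW : (size (W * 'X^P)%R <= P)%N.
  rewrite -eW (leq_trans (size_polyD _ _)) // size_polyN geq_max.
  rewrite (leq_trans (size_scale_leq _ _)); last by apply: leq_trans (sz _ sB) _; lia.
  rewrite andbT; apply: leq_trans (size_polyMleq _ _) _.
  move: (sz _ sA); set u := size _; set w := size _ => su; lia.
have W0: W = 0.
  apply/eqP; apply: contraTT sW => W0; rewrite size_mulXn // -ltnNge.
  by rewrite -[X in (X < _)%N]addn0 ltn_add2l lt0n size_poly_eq0.
move/eqP: eW; rewrite W0 mul0r subr_eq0 => /eqP eW.
have [A00 B00] := eq_sqr_mul_mup1 fn0 mf c0 eW.
have e' : A' + B' * G = 0.
  move/eqP: e; rewrite A00 B00 mul0r !add0r mulf_eq0 (negPf (monic_neq0 (monicXn _ P))) orbF.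
  by move/eqP.
case=> // j /=; rewrite ltnS => jn.
apply: (IHn (fun j => A j.+1) (fun j => B j.+1) _ _ j jn); first by move=> i; apply: sAB.
by rewrite -[RHS]e' /A' /B' mulr_suml -big_split /=; apply: eq_bigr => i _; ring.
Qed.

Lemma additive_pigeonhole (V W : finZmodType) (h : V -> W) :
  {morph h : x y / x - y} -> (#|W| < #|V|)%N -> exists2 v, v != 0 & h v = 0.
Proof.
move=> hB; rewrite ltnNge => ltWV.
have /injectivePn[x [y neq_xy eq_h]] : ~~ injectiveb h.
  by apply: contra ltWV => /injectiveP/leq_card.
by exists (x - y); rewrite ?subr_eq0 // hB eq_h subrr.
Qed.

(* With G = f^((P-1)/2), a point y of the set satisfies y^(P^2) = y and G(y)^(P+1) = -1, so that
   G(y) g(y)^P = U(y) for g = sum_j (A_j + B_j G) X^(jP), where U is a polynomial of small degree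
   depending on the P-th powers of the coefficients of the A_j and B_j.  Choosing them so that
   U = 0 makes all these y roots of g. *)
Lemma stepanov_bound (L : finFieldType) (P D : nat) (f : {poly L}) (rho : L) :
  [pchar L].-nat P -> odd P -> ~~ odd D -> (D ^ 2 < P)%N ->
  size f = D.+1 -> f.[0] != 0 -> mup rho f = 1%N ->
  (2 * #|[set y : L | ((y ^+ (P ^ 2) == y)
                      && (f.[y] ^+ ((P ^ 2).-1)./2 == -1))%R]| <= P ^ 2 + 2 * D * P)%N.
Proof.
move=> cP oddP evD DP sf f0 mf.
have [P' defP] : exists P', P = P'.*2.+1.
  by exists P./2; rewrite -[LHS]odd_double_half oddP.
have [D' defD] : exists D', D = D'.*2.
  by exists D./2; rewrite -[LHS]odd_double_half (negPf evD).
have ltDP: (D < P)%N by apply: leq_ltn_trans DP; case: (D) => // i; rewrite -mulnn leq_pmull.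
(* K is the largest size that [stepanov_nonvanishing] allows: 2 K + D + 1 = P + 2. N is then just
   large enough for the 2 K N unknowns to outnumber the T coefficients of [U]: with P = 2 P' + 1 and
   D = 2 D', the difference 2 K N - T is P - 2 D'^2. *)
pose K := (P'.+1 - D')%N; pose N := (P' + D').+1.
pose G := f ^+ P'; pose T := ((K - 1) * P + P' * D + N)%N.
have eG : G ^+ 2 * f = f ^+ P by rewrite /G defP [RHS]exprS -muln2 exprM mulrC.
pose U (v : 'M[L]_(N, K + K)) : {poly L} :=
  \sum_(j < N) ((rVpoly (row j (lsubmx v)) \Po 'X^P) * G
                - (rVpoly (row j (rsubmx v)) \Po 'X^P)) * 'X^j.
have sG : (size G <= (P' * D).+1)%N.
  by apply: leq_trans (size_poly_exp_leq _ _) _; rewrite sf /= mulnC.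
have sMX (p : {poly L}) m : (size (p * 'X^m)%R <= size p + m)%N.
  by apply: leq_trans (size_polyMleq _ _) _; rewrite size_polyXn addnS.
have sU v : (size (U v) <= T)%N.
  apply: (leq_trans (size_sum _ _ _)); apply/bigmax_leqP => j _.
  have sC (u : 'rV[L]_K) : (size (rVpoly u \Po 'X^P)%R <= ((K - 1) * P).+1)%N.
    apply: leq_trans (size_comp_poly_leq _ _) _; rewrite size_polyXn ltnS leq_mul2r.
    apply/orP; right; rewrite -subn1 leq_sub2r //.
    exact: size_poly.
  apply: leq_trans (sMX _ _) _.
  have : (size (((rVpoly (row j (lsubmx v)) \Po 'X^P) * G)
                - (rVpoly (row j (rsubmx v)) \Po 'X^P))%R <= ((K - 1) * P + P' * D).+1)%N.
    rewrite (leq_trans (size_polyD _ _)) // size_polyN geq_max; apply/andP; split.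
      apply: leq_trans (size_polyMleq _ _) _; move: (sC (row j (lsubmx v))) sG.
      set u := size _; set w := size _ => su sw; lia.
    by apply: leq_trans (sC _) _; rewrite ltnS leq_addr.
  set u := size _ => su; rewrite /T; have := ltn_ord j; lia.
have [v v0 Uv] : exists2 v, v != 0 & U v = 0.
  have ltTV : (#|'rV[L]_T| < #|'M[L]_(N, K + K)|)%N.
    rewrite !card_mx mul1n ltn_exp2l ?finNzRing_gt1 // /T /K /N defP.
    have : (4 * (D' * D') < P'.*2.+1)%N by move: DP; rewrite defP defD -mulnn; lia.
    have [x ->] : exists x, P' = (D' + x)%N by exists (P' - D')%N; lia.
    by rewrite (_ : (D' + x).+1 - D' = x.+1)%N; [lia | lia].
  have hB : {morph (fun v : 'M[L]_(N, K + K) => poly_rV (U v) : 'rV[L]_T) : x y / x - y}.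
    move=> x y; rewrite -linearB /=; congr poly_rV.
    rewrite /U -sumrB; apply: eq_bigr => j _.
    by rewrite !linearB /=; ring.
  have [v v0 /(congr1 rVpoly)] := additive_pigeonhole hB ltTV.
  by rewrite poly_rV_K // linear0 => Uv; exists v.
(* The entries of [v] are the P-th powers of the coefficients of the A_j and B_j, which is what
   makes [U] additive in [v]; the coefficients themselves are recovered by P-th roots. *)
pose fr_inv := invF (expr_pchar_inj cP).
have fr_invK x : fr_inv x ^+ P = x by apply: (f_invF (expr_pchar_inj cP)).
pose AO (a : 'M[L]_(N, K)) (j : nat) : {poly L} :=
  oapp (fun j' : 'I_N => rVpoly (map_mx fr_inv (row j' a))) 0 (insub j).
have AOE a (j : 'I_N) : AO a j = rVpoly (map_mx fr_inv (row j a)) by rewrite /AO valK.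
have AO_eval a (j : 'I_N) y : (AO a j).[y] ^+ P = (rVpoly (row j a)).[y ^+ P].
  rewrite AOE !horner_poly expr_sum_pchar //; apply: eq_bigr => i _.
  by rewrite !valK exprMn !mxE fr_invK exprAC.
pose g := \sum_(j < N) (AO (lsubmx v) j + AO (rsubmx v) j * G) * 'X^(j * P).
have g0 : g != 0.
  apply: contraNneq v0 => g0.
  have AB0 : forall j, (j < N)%N -> AO (lsubmx v) j = 0 /\ AO (rsubmx v) j = 0.
    apply: (stepanov_nonvanishing (k := K) _ cP _ f0 mf eG _ g0); first by lia.
      by rewrite sf; lia.
    by move=> j; rewrite /AO; case: insub => [j'|] /=; rewrite ?size_poly ?size_poly0.
  have a0 a : (forall j : 'I_N, AO a j = 0) -> a = 0.
    move=> a0; apply/row_matrixP => j; rewrite row0; apply/rowP => i.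
    have /(congr1 (@poly_rV _ K)) := a0 j; rewrite AOE rVpolyK linear0 => /rowP/(_ i).
    by rewrite !mxE => /(congr1 (fun x => x ^+ P)); rewrite fr_invK expr0n gtn_eqF // defP.
  have l0 : lsubmx v = 0 by apply: a0 => j; case: (AB0 j (ltn_ord j)).
  have r0 : rsubmx v = 0 by apply: a0 => j; case: (AB0 j (ltn_ord j)).
  by rewrite -[v]hsubmxK l0 r0 row_mx0.
have sg : (size g <= (K - 1) + P' * D + (N - 1) * P + 1)%N.
  apply: (leq_trans (size_sum _ _ _)); apply/bigmax_leqP => j _.
  apply: leq_trans (sMX _ _) _.
  have sAO a : (size (AO a j) <= K)%N by rewrite AOE; apply: size_poly.
  have : (size (AO (lsubmx v) j + AO (rsubmx v) j * G)%R <= (K - 1) + P' * D + 1)%N.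
    rewrite (leq_trans (size_polyD _ _)) // geq_max; apply/andP; split.
      by apply: leq_trans (sAO _) _; lia.
    apply: leq_trans (size_polyMleq _ _) _; move: (sAO (rsubmx v)) sG.
    set u := size _; set w := size _ => su sw; lia.
  set u := size _ => su; have jN := ltn_ord j.
  have : (j * P <= (N - 1) * P)%N by rewrite leq_mul2r; apply/orP; right; lia.
  lia.
set S := [set y | _].
have gS : all (root g) (enum S).
  apply/allP => y; rewrite mem_enum inE => /andP[/eqP yQ /eqP yN].
  have GG : G.[y] ^+ P.+1 = -1.
    rewrite /G horner_exp -exprM -yN; congr (_ ^+ _).
    rewrite defP; lia.
  have : G.[y] * g.[y] ^+ P = 0.
    rewrite -(horner0 y) -Uv /U /g !horner_sum expr_sum_pchar // mulr_sumr.
    apply: eq_bigr => j _; rewrite !hornerE !horner_comp !hornerE exprMn exprDn_pchar //.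
    rewrite exprMn !AO_eval.
    have yj : y ^+ (j * P) ^+ P = y ^+ j by rewrite -!exprM -mulnA mulnn mulnC exprM yQ.
    have {}GG : f.[y] ^+ P' * f.[y] ^+ P' ^+ P = -1 by rewrite -exprS -horner_exp.
    rewrite yj mulrA mulrDr; congr (_ * _).
    by rewrite mulrCA GG mulrN1 mulrC.
  move/eqP; rewrite mulf_eq0 expf_eq0 => /orP[/eqP G0|/andP[] //].
  by move/eqP: GG; rewrite G0 expr0n eq_sym oppr_eq0 oner_eq0.
have := max_poly_roots g0 gS (enum_uniq _); rewrite -cardE => ltS.
have : (#|S| <= (K - 1) + P' * D + (N - 1) * P)%N.
  by rewrite -ltnS; apply: leq_trans ltS _; rewrite -addn1.
rewrite defP /K /N defD => leS.
have -> : (P'.*2.+1 ^ 2 = P' * P'.*2.+1 + P' * P'.*2.+1 + P'.*2.+1)%N by rewrite -mulnn; lia.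
have : (0 <= D' * P')%N by []; lia.
Qed.

(** * Products of Frobenius conjugates over an extension of a finite field *)

Lemma card_pchar_nat (F : finFieldType) (L : fieldType) (io : {rmorphism F -> L}) k :
  [pchar L].-nat (#|F| ^ k)%N.
Proof.
have [p p_pr cp] := finPcharP F.
rewrite (card_pprimeChar cp) -expnM pnatX; apply/orP; left.
by rewrite pnatE // (fmorph_pchar io).
Qed.

Section FrobeniusProducts.
Variables (F L : finFieldType) (io : {rmorphism F -> L}).
Let q := #|F|.

Lemma frob_exists (P : nat) :
  [pchar L].-nat P -> exists fr : {rmorphism L -> L}, forall x, fr x = x ^+ P.
Proof.
move=> cP; pose f (x : L) := x ^+ P.
have fB : zmod_morphism f by move=> x y; rewrite /f exprB_pchar.
have fM : monoid_morphism f by split=> [|x y]; rewrite /f ?expr1n ?exprMn.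
pose fA := GRing.isZmodMorphism.Build L L f fB.
pose fMM := GRing.isMonoidMorphism.Build L L f fM.
by exists (HB.pack f fA fMM : {rmorphism L -> L}).
Qed.

Lemma io_frob x : io x ^+ q = io x.
Proof. by rewrite -rmorphXn expf_card. Qed.

Lemma frob_fixed_io c : c ^+ q = c -> exists x, c = io x.
Proof.
move=> cq; have := congr1 (map_poly io) (finField_genPoly F).
rewrite rmorphB rmorph_prod /= map_polyXn map_polyX => e.
have : root ('X^q - 'X) c by rewrite /root !hornerE cq subrr.
rewrite e /root horner_prod => /prodf_eq0[x _].
by rewrite map_polyXsubC !hornerE subr_eq0 => /eqP ->; exists x.
Qed.

(** When r^(q^k) = r, this is the characteristic polynomial over F of r as an element of the
    extension of degree k, hence a power of its minimal polynomial. *)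
Definition frob_prod (r : L) (k : nat) : {poly L} :=
  \prod_(i < k) ('X - (r ^+ (q ^ i))%:P).

Lemma frob_prodD r i j :
  frob_prod r (i + j) = frob_prod r i * frob_prod (r ^+ (q ^ i)) j.
Proof.
rewrite /frob_prod big_split_ord; congr (_ * _) => /=.
by apply: eq_bigr => l _; rewrite -exprM -expnD.
Qed.

Lemma frob_prodM r d m :
  r ^+ (q ^ d) = r -> frob_prod r (m * d) = frob_prod r d ^+ m.
Proof.
move=> rd; elim: m => [|m IHm]; first by rewrite /frob_prod big_ord0.
by rewrite mulSn frob_prodD rd IHm exprS.
Qed.

Lemma frob_prod_monic r k : frob_prod r k \is monic.
Proof. by apply: monic_prod => i _; apply: monicXsubC. Qed.

Lemma size_frob_prod r k : size (frob_prod r k) = k.+1.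
Proof. by rewrite /frob_prod size_prod_XsubC -[index_enum _]enumT size_enum_ord. Qed.

Lemma map_poly_frob_io (fr : {rmorphism L -> L}) (p : {poly F}) :
  (forall x, fr x = x ^+ q) -> map_poly fr (map_poly io p) = map_poly io p.
Proof.
move=> frE; rewrite -map_poly_comp; apply: eq_map_poly => x /=.
by rewrite frE io_frob.
Qed.

Lemma poly_descent (fr : {rmorphism L -> L}) (p : {poly L}) :
  (forall x, fr x = x ^+ q) -> map_poly fr p = p -> exists p0, p = map_poly io p0.
Proof.
move=> frE pfr; pose g c := odflt 0 [pick x | io x == c].
have gK c : c ^+ q = c -> io (g c) = c.
  move=> /frob_fixed_io[x ->]; rewrite /g; case: pickP => [y /eqP //|/(_ x)].
  by rewrite eqxx.
exists (\poly_(i < size p) g p`_i); apply/polyP => i.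
rewrite coef_map /= coef_poly; case: ltnP => [_|sz]; last by rewrite rmorph0 nth_default.
by rewrite gK // -frE -coef_map /= pfr.
Qed.

Lemma frob_prod_descent r k :
  r ^+ (q ^ k) = r -> exists p0, frob_prod r k = map_poly io p0.
Proof.
move=> rk.
have [fr frE] : exists fr : {rmorphism L -> L}, forall x, fr x = x ^+ q.
  by apply: frob_exists; rewrite -[q]expn1; apply: card_pchar_nat.
apply: (poly_descent frE); rewrite /frob_prod rmorph_prod /=.
under eq_bigr => i _ do rewrite map_polyXsubC /= frE -exprM -expnSr.
case: k rk => [|k] rk; first by rewrite !big_ord0.
by rewrite big_ord_recr big_ord_recl /= rk expn0 expr1 mulrC.
Qed.

Lemma dvdp_prod_XsubC_exp (s : seq L) (p : {poly L}) m :
  uniq s -> (forall x, x \in s -> ('X - x%:P) ^+ m %| p) ->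
  (\prod_(x <- s) ('X - x%:P)) ^+ m %| p.
Proof.
elim: s => [|x s IHs] /=; first by rewrite big_nil expr1n dvd1p.
case/andP=> xs us sp; rewrite big_cons exprMn Gauss_dvdp.
  by rewrite sp ?mem_head // IHs // => y ys; apply: sp; rewrite inE ys orbT.
rewrite coprimep_expl // coprimep_expr // coprimep_sym coprimep_XsubC.
by rewrite root_prod_XsubC.
Qed.

(** Here d is the degree of r over F, obtained as the length of its Frobenius orbit. *)
Lemma frob_period (r : L) : exists d, [/\ (0 < d)%N, r ^+ (q ^ d) = r,
  (forall k, r ^+ (q ^ k) = r -> (d %| k)%N) &
  uniq [seq r ^+ (q ^ i) | i <- iota 0 d]].
Proof.
have cq : [pchar L].-nat q by rewrite -[q]expn1; apply: card_pchar_nat.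
pose f (x : L) := x ^+ q.
have itf i x : iter i f x = x ^+ (q ^ i).
  elim: i => [|i IHi] /=; first by rewrite expn0 expr1.
  by rewrite IHi /f -exprM expnSr.
have finj : injective f := expr_pchar_inj cq.
have rd : r ^+ (q ^ order f r) = r by rewrite -itf iter_order.
exists (order f r); split=> //; last 1 first.
- suff -> : [seq r ^+ (q ^ i) | i <- iota 0 (order f r)] = orbit f r by apply: orbit_uniq.
  apply: (@eq_from_nth _ r); first by rewrite size_map size_iota size_orbit.
  rewrite size_map size_iota => i iS.
  by rewrite (nth_map 0%N) ?size_iota // nth_iota // nth_traject // itf.
move=> k; rewrite {1}(divn_eq k (order f r)) /dvdn => rk.
have rm m : r ^+ (q ^ (m * order f r)) = r.
  elim: m => [|m IHm]; first by rewrite mul0n expr1.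
  by rewrite mulSn expnD exprM rd.
move: rk; rewrite expnD exprM rm -itf => rk.
have lt := ltn_pmod k (order_gt0 f r).
have := findex_iter lt; rewrite rk findex0 => <- //.
Qed.

(** L stands for an algebraic closure as far as degrees below B are concerned: the extensions of
    small degree k all sit in it, as the solutions of r^(q^k) = r. *)
Definition splits_upto (B : nat) := forall p : {poly F}, p != 0 -> (size p <= B)%N ->
  exists rs : seq L, map_poly io p %= \prod_(r <- rs) ('X - r%:P).

(** As p is fixed by Frobenius, the d distinct conjugates of r have the same multiplicity in p, so
    divisibility by the m-th power of their product is decided at r alone. *)
Lemma dvdp_frob_prodM (fr : {rmorphism L -> L}) (p : {poly L}) r d m :
  (forall x, fr x = x ^+ q) -> map_poly fr p = p -> p != 0 -> (0 < d)%N ->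
  r ^+ (q ^ d) = r -> uniq [seq r ^+ (q ^ i) | i <- iota 0 d] ->
  (frob_prod r (m * d) %| p) = (m <= mup r p)%N.
Proof.
move=> frE pfr p0 d0 rd ud; rewrite frob_prodM //.
have eF : frob_prod r d = \prod_(x <- [seq r ^+ (q ^ i) | i <- iota 0 d]) ('X - x%:P).
  by rewrite big_map -[d in iota _ d]subn0 -/(index_iota 0 d) big_mkord.
apply/idP/idP => [dv|le_m].
  rewrite mup_geq //; apply: dvdp_trans dv; rewrite dvdp_exp2r //.
  rewrite eF dvdp_XsubCl root_prod_XsubC; apply/mapP; exists 0%N; first by rewrite mem_iota.
  by rewrite expr1.
rewrite eF; apply: dvdp_prod_XsubC_exp => // x /mapP[i _ ->] {x}.
elim: i => [|i IHi]; first by rewrite expr1 -mup_geq.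
have /= := IHi; rewrite -(dvdp_map fr) pfr rmorphXn /= map_polyXsubC /= frE.
by rewrite -exprM -expnSr.
Qed.

Lemma count_multiples d v n : (0 < d)%N -> (v * d <= n)%N ->
  (\sum_(1 <= k < n.+1) ((d %| k) && (k %/ d <= v)) = v)%N.
Proof.
move=> d0 vd; rewrite -big_mkcond /= sum1_count -size_filter.
rewrite -[RHS](size_iota 1) -[RHS](size_map (fun j => j * d)%N); apply: perm_size.
apply: uniq_perm; first by rewrite filter_uniq ?iota_uniq.
  by rewrite map_inj_uniq ?iota_uniq // => i j /eqP; rewrite eqn_pmul2r // => /eqP.
move=> k; rewrite mem_filter mem_index_iota; apply/idP/mapP.
  case/andP=> /andP[/dvdnP[j ->]]; rewrite mulnK // => jv /andP[j0 _].
  by exists j => //; rewrite mem_iota; move: j0; case: j jv.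
case=> j; rewrite mem_iota add1n ltnS => /andP[j0 jv] ->.
rewrite dvdn_mull // mulnK // jv muln_gt0 j0 d0 ltnS /=.
by apply: leq_trans vd; rewrite leq_mul2r jv orbT.
Qed.

(* A root r of multiplicity m with d conjugates is counted for the degrees d, 2 d, ..., m d. *)
Lemma sum_frob_prod_dvdp (p : {poly F}) (B n : nat) :
  splits_upto B -> p \is monic -> size p = n.+1 -> (n < B)%N -> p`_0 != 0 ->
  (\sum_(1 <= k < n.+1)
     #|[set r : L | [&& r != 0, r ^+ (q ^ k) == r & frob_prod r k %| map_poly io p]%R]| = n)%N.
Proof.
move=> spl pm sp nB p00.
have cq : [pchar L].-nat q by rewrite -[q]expn1; apply: card_pchar_nat.
have [fr frE] := frob_exists cq.
set P := map_poly io p.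
have Pm : P \is monic by rewrite map_monic.
have P0 : P != 0 by apply: monic_neq0.
have sP : size P = n.+1 by rewrite size_map_poly.
have [|rs] := spl p (monic_neq0 pm); first by rewrite sp.
rewrite -/P eqp_monic ?monic_prod_XsubC // => /eqP eP.
have szr : size rs = n by apply: succn_inj; rewrite -sP eP size_prod_XsubC.
transitivity (\sum_(r : L) mup r P)%N; last first.
  have mE r : mup r P = (\sum_(s <- rs) (s == r))%N.
    by rewrite eP mu_prod_XsubC -sum1_count big_mkcond; apply: eq_bigr => s _ /=; case: (s == r).
  under eq_bigr => r _ do rewrite mE.
  rewrite exchange_big -szr -sum1_size /=; apply: eq_bigr => r _.
  by rewrite -big_mkcond (big_pred1 r) // => i; rewrite /= eq_sym.
under eq_bigr => k _ do rewrite -sum1_card.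
under eq_bigr => k _ do rewrite big_mkcond.
rewrite exchange_big /=; apply: eq_bigr => r _.
under eq_bigr => k _ do rewrite inE.
have [->|r0] := eqVneq r 0.
  rewrite big1 // mupNroot //.
  by rewrite /root horner_coef0 coef_map fmorph_eq0.
have [d [d0 rd dv ud]] := frob_period r.
rewrite -[RHS](count_multiples (n := n) d0); last first.
  have : frob_prod r (mup r P * d) %| P by rewrite (dvdp_frob_prodM _ frE) ?map_poly_frob_io.
  by move/dvdp_leq => /(_ P0); rewrite size_frob_prod sP.
apply: eq_bigr => k _; rewrite /=.
have [/dvdnP[m ->]|ndk] /= := boolP (d %| k)%N; last first.
  by case: eqP => // /dv dk; rewrite dk in ndk.
rewrite mulnK // (dvdp_frob_prodM _ frE) ?map_poly_frob_io //.
suff -> : r ^+ (q ^ (m * d)) == r by case: (m <= _)%N.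
elim: m => [|m /eqP IHm]; first by rewrite expr1.
by rewrite mulSn expnD exprM rd IHm.
Qed.
End FrobeniusProducts.

(** * The L-function of a Kloosterman sum *)

(* If p is the product of the X - s_i then [kloos_form a p] is - sum_i (s_i + a / s_i): p`_1 / p`_0
   is minus the sum of the inverses of the roots.  The factor 'X makes the first term 0 when p is
   constant. *)
Definition kloos_form (R : fieldType) (a : R) (p : {poly R}) : R :=
  ('X * p)`_(size p).-1 + a * (p`_1 / p`_0).

Lemma kloos_form_mulXsubC (R : fieldType) (a s : R) (p : {poly R}) :
  p \is monic -> p`_0 != 0 -> s != 0 ->
  kloos_form a (('X - s%:P) * p) = kloos_form a p - (s + a / s).
Proof.
move=> pm p0 s0; rewrite /kloos_form.
have sp : size p = (size p).-1.+1 by rewrite prednK // size_poly_gt0 monic_neq0.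
have -> : size (('X - s%:P) * p) = (size p).+1.
  by rewrite size_monicM ?monicXsubC ?monic_neq0 // size_XsubC.
have lp : p`_(size p).-1 = 1 by have /eqP := pm.
rewrite /= coefXM sp /= !mulrBl !coefB !coefXM !coefCM /=.
rewrite lp; case: ((size p).-1 == 0)%N; field.
all: by rewrite s0 p0 oppr_eq0 mulf_neq0.
Qed.

Lemma kloos_form_prod (R : fieldType) (a : R) (I : Type) (l : seq I) (s : I -> R) (p : {poly R}) :
  p \is monic -> p`_0 != 0 -> (forall i, s i != 0) ->
  kloos_form a (\prod_(i <- l) ('X - (s i)%:P) * p)
    = kloos_form a p - \sum_(i <- l) (s i + a / s i).
Proof.
move=> pm p0 s0; elim: l => [|i l IHl]; first by rewrite !big_nil mul1r subr0.
rewrite !big_cons -mulrA kloos_form_mulXsubC // ?IHl; first by ring.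
  by rewrite monicMr // monic_prod_XsubC.
rewrite -horner_coef0 hornerM horner_prod horner_coef0 mulf_neq0 //.
rewrite prodf_seq_neq0; elim: {IHl} l => //= j l ->.
by rewrite !hornerE oppr_eq0 s0.
Qed.

Lemma kloos_form_map (R S : fieldType) (f : {rmorphism R -> S}) (a : R) (p : {poly R}) :
  kloos_form (f a) (map_poly f p) = f (kloos_form a p).
Proof.
rewrite /kloos_form size_map_poly !coefXM !coef_map rmorphD rmorphM fmorph_div.
by case: eqP; rewrite ?rmorph0.
Qed.

Definition monic_of (R : nzRingType) n (v : 'rV[R]_n) : {poly R} := 'X^n + rVpoly v.

Section MonicOf.
Variables (R : nzRingType) (n : nat).
Implicit Types (v : 'rV[R]_n) (p : {poly R}).

Lemma size_monic_of v : size (monic_of v) = n.+1.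
Proof. by rewrite size_polyDl size_polyXn // ltnS size_poly. Qed.

Lemma coef_monic_of v (i : 'I_n) : (monic_of v)`_i = v 0 i.
Proof. by rewrite coefD coefXn ltn_eqF // add0r coef_rVpoly_ord. Qed.

Lemma monic_of_monic v : monic_of v \is monic.
Proof.
rewrite monicE lead_coefE size_monic_of /= coefD coefXn eqxx nth_default ?addr0 //.
exact: size_poly.
Qed.

Lemma monic_ofK v : poly_rV (monic_of v - 'X^n) = v.
Proof. by rewrite /monic_of addrC addKr rVpolyK. Qed.

Lemma monic_of_surj p : p \is monic -> size p = n.+1 -> monic_of (poly_rV (p - 'X^n) : 'rV_n) = p.
Proof.
move=> pm sp; rewrite /monic_of poly_rV_K; first by rewrite addrC subrK.
apply/leq_sizeP => j; rewrite leq_eqVlt coefB coefXn => /orP[/eqP <-|nj].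
  by have := pm; rewrite monicE lead_coefE sp /= => /eqP ->; rewrite eqxx subrr.
by rewrite nth_default ?sp // gtn_eqF // subrr.
Qed.

End MonicOf.

Section LFunction.
Variables (F L : finFieldType) (io : {rmorphism F -> L}) (B : nat).
Hypothesis spl : splits_upto io B.
Variables (chi : F -> algC) (a b : F).
Hypothesis chiD : forall x y, chi (x + y) = chi x * chi y.
Local Notation q := #|F|.

(* The preimage under [io] of the trace of [r + a / r]; meaningful when [r ^+ (q ^ k) = r]. *)
Definition ext_trace (k : nat) (r : L) : F :=
  odflt 0 [pick x | io x == \sum_(i < k) (r + io a / r) ^+ (q ^ i)].

(** The coefficient of T^n in the L-function of the character f -> chi (- b * kloos_form a f), which
    is multiplicative on monic polynomials prime to X because [kloos_form] is additive on
    products. *)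
Definition Lcoef (n : nat) : algC :=
  \sum_(v : 'rV[F]_n | (monic_of v)`_0 != 0) chi (- (b * kloos_form a (monic_of v))).

Definition kloos_ext (k : nat) : algC :=
  \sum_(r : L | (r != 0) && (r ^+ (q ^ k) == r)) chi (b * ext_trace k r).

Lemma ext_traceE k r : r ^+ (q ^ k) = r ->
  io (ext_trace k r) = \sum_(i < k) (r + io a / r) ^+ (q ^ i).
Proof.
move=> rk; rewrite /ext_trace; case: pickP => [x /eqP //|nx].
have cq m : [pchar L].-nat (q ^ m)%N := card_pchar_nat io m.
have [|x ex] := @frob_fixed_io _ _ io (\sum_(i < k) (r + io a / r) ^+ (q ^ i)).
  rewrite -[q]expn1 expr_sum_pchar //.
  under eq_bigr => i _ do rewrite -exprM -expnD addn1.
  case: k rk {nx} => [|k] rk; first by rewrite !big_ord0.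
  rewrite big_ord_recr big_ord_recl /= expn0 expr1 addrC; congr (_ + _).
  rewrite exprDn_pchar // rk expr_div_n rk; congr (_ + _ / _).
  elim: (k.+1) => [|m IHm]; first by rewrite expr1.
  by rewrite expnSr exprM IHm io_frob.
by have := nx x; rewrite ex eqxx.
Qed.

(** The product of the conjugates of r comes from a polynomial phi over F, and its multiples of
    degree n are phi times the monic polynomials of degree n - k. By multiplicativity phi
    contributes the factor chi (b * trace). *)
Lemma Lcoef_dvdp n k r : (k <= n)%N -> r != 0 -> r ^+ (q ^ k) = r ->
  \sum_(v : 'rV[F]_n | ((monic_of v)`_0 != 0) && (frob_prod F r k %| map_poly io (monic_of v)))
     chi (- (b * kloos_form a (monic_of v)))
  = chi (b * ext_trace k r) * Lcoef (n - k).
Proof.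
move=> kn r0 rk; have [phi ephi] := frob_prod_descent io rk.
have phim : phi \is monic by rewrite -(map_monic io) -ephi frob_prod_monic.
have sphi : size phi = k.+1 by rewrite -(size_map_poly io) -ephi size_frob_prod.
have phi00 : phi`_0 != 0.
  rewrite -(fmorph_eq0 io) -coef_map /= -ephi -horner_coef0 horner_prod.
  by apply/prodf_neq0 => j _; rewrite !hornerE oppr_eq0 expf_neq0.
rewrite (reindex_onto (fun w : 'rV[F]_(n - k) => poly_rV (phi * monic_of w - 'X^n))
  (fun v => poly_rV (monic_of v %/ phi - 'X^(n - k)))); last first.
  move=> v /andP[_]; rewrite ephi dvdp_map => dv.
  rewrite monic_of_surj ?divpKC ?monic_ofK //.
    by rewrite -(monicMl _ phim) mulrC divpK // monic_of_monic.
  by rewrite size_divp ?monic_neq0 // size_monic_of sphi subSn.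
have mE (w : 'rV[F]_(n - k)) :
    monic_of (poly_rV (phi * monic_of w - 'X^n) : 'rV_n) = phi * monic_of w.
  rewrite monic_of_surj ?monicMl ?monic_of_monic // size_Mmonic ?monic_of_monic ?monic_neq0 //.
  by rewrite sphi size_monic_of addSn /= addnS subnKC.
rewrite mulr_sumr; apply: eq_big => w.
  rewrite mE mulKp ?monic_neq0 // monic_ofK eqxx andbT rmorphM /= -ephi dvdp_mulr // andbT.
  by rewrite -!horner_coef0 hornerM mulf_eq0 negb_or !horner_coef0 phi00.
case/andP=> /andP[]; rewrite mE => nz _ _.
have w0 : (monic_of w)`_0 != 0.
  by move: nz; rewrite -!horner_coef0 hornerM mulf_eq0 negb_or => /andP[].
rewrite -chiD; congr chi; rewrite -mulrN -mulrN -mulrDr; congr (_ * _).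
apply: (fmorph_inj io); rewrite rmorphN -kloos_form_map rmorphM /= -ephi.
rewrite /frob_prod kloos_form_prod ?map_monic ?monic_of_monic //; first last.
- by move=> i; rewrite expf_neq0.
- by rewrite coef_map fmorph_eq0.
rewrite kloos_form_map opprB rmorphB /= ext_traceE //; congr (_ - _).
apply: eq_bigr => i _.
rewrite exprDn_pchar ?(card_pchar_nat io) // expr_div_n; congr (_ + _ / _).
elim: (nat_of_ord i) => [|m IHm]; first by rewrite expr1.
by rewrite expnSr exprM -IHm io_frob.
Qed.

(** The coefficient form of T L' = L * (sum over k of K_k T^k). By [sum_frob_prod_dvdp] the factor n
    counts the pairs (k, r) such that [frob_prod] of r divides the polynomial; exchanging the sums
    groups the polynomials by such a divisor. *)
Lemma Lcoef_newton n : (n < B)%N ->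
  n%:R * Lcoef n = \sum_(1 <= k < n.+1) kloos_ext k * Lcoef (n - k).
Proof.
move=> nB; rewrite /Lcoef mulr_sumr.
transitivity (\sum_(v : 'rV[F]_n | (monic_of v)`_0 != 0)
  \sum_(1 <= k < n.+1)
    \sum_(r : L | [&& r != 0, r ^+ (q ^ k) == r & frob_prod F r k %| map_poly io (monic_of v)])
    chi (- (b * kloos_form a (monic_of v)))).
  apply: eq_bigr => v v0.
  rewrite -{1}(sum_frob_prod_dvdp spl (monic_of_monic v) (size_monic_of v) nB v0).
  rewrite natr_sum mulr_suml; apply: eq_bigr => k _.
  by rewrite sumr_const mulr_natl; congr (_ *+ _); apply: eq_card => r; rewrite inE.
rewrite exchange_big /= !big_nat; apply: eq_bigr => k /andP[k0 kn].
rewrite (exchange_big_dep (fun r : L => (r != 0) && (r ^+ (q ^ k) == r))) /=; last first.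
  by move=> v r _ /and3P[-> ->].
rewrite mulr_suml; apply: eq_bigr => r /andP[r0 /eqP rk].
rewrite -(Lcoef_dvdp _ r0 rk) //.
by apply: eq_bigl => v; rewrite r0 rk eqxx.
Qed.

End LFunction.

Section LCoefficients.
Variables (F : finFieldType).
Variables (chi : F -> algC) (a b : F).
Hypothesis chiD : forall x y, chi (x + y) = chi x * chi y.
Hypothesis chi0 : chi 0 = 1.
Variable t0 : F.
Hypothesis chi1 : chi t0 != 1.
Hypothesis a0 : a != 0.
Hypothesis b0 : b != 0.
Local Notation q := #|F|.
Local Notation c := (Lcoef chi a b).

Lemma sum_chi_mul (u : F) : \sum_(x : F) chi (x * u) = if u == 0 then q%:R else 0.
Proof.
case: eqP => [->|/eqP u0].
  by under eq_bigr => x _ do rewrite mulr0 chi0; rewrite sumr_const.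
have e : \sum_x chi (x * u) = chi t0 * \sum_x chi (x * u).
  rewrite {1}(reindex_inj (addrI (t0 / u))) mulr_sumr; apply: eq_bigr => x _.
  by rewrite mulrDl chiD divfK.
apply/eqP; move/eqP: e; rewrite -subr_eq0 -[X in X - _]mul1r -mulrBl mulf_eq0 subr_eq0 eq_sym.
by rewrite (negPf chi1).
Qed.

Lemma Lcoef0 : c 0 = 1.
Proof.
have m1 (v : 'rV[F]_0) : monic_of v = 1.
  by rewrite /monic_of (thinmx0 v) linear0 addr0.
rewrite /Lcoef (big_pred1 0) => [|v].
  by rewrite m1 /kloos_form size_poly1 coefXM !coef1 /= mul0r mulr0 addr0 mulr0 oppr0.
by rewrite m1 coef1 oner_neq0 /= thinmx0 eqxx.
Qed.

Lemma Lcoef1 : c 1 = \sum_(x : F | x != 0) chi (b * (x + a / x)).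
Proof.
rewrite /Lcoef (reindex (fun x : F => \row_(j < 1) - x)) /=; last first.
  exists (fun v : 'rV_1 => - v 0 0) => [x _|v _]; first by rewrite mxE opprK.
  by apply/rowP => j; rewrite mxE opprK (ord1 j).
have mE (x : F) : monic_of (\row_(j < 1) - x) = 'X - x%:P.
  apply/polyP => -[|[|i]]; rewrite /monic_of !coefD coefN !coefXn coefC coef_rVpoly /=.
  - by case: insubP => // j _ _; rewrite mxE !add0r.
  - by case: insubP => // _; rewrite subr0 addr0.
  - by case: insubP => // _; rewrite subr0 addr0.
apply: eq_big => [x|x x0]; first by rewrite mE coefB coefX coefC sub0r oppr_eq0.
rewrite mE; congr chi; rewrite -mulrN -[_ - _]mulr1 kloos_form_mulXsubC ?monic1 ?coef1 ?oner_eq0 //.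
  by rewrite /kloos_form size_poly1 coefXM !coef1 /= mul0r mulr0 addr0 sub0r opprK.
by apply: contraNneq x0; rewrite mE coefB coefX coefC sub0r => ->; rewrite oppr0.
Qed.

(** On X^2 + y X + x the form is y (1 + a / x), so the sum over y vanishes except for x = - a, where
    it is q. *)
Lemma Lcoef2 : c 2 = q%:R.
Proof.
pose h (xy : F * F) : 'rV[F]_2 := \row_(j < 2) (if j == 0 then xy.1 else xy.2).
rewrite /Lcoef (reindex h) /=; last first.
  exists (fun v : 'rV_2 => (v 0 0, v 0 1)) => [[x y] _|v _] /=; first by rewrite !mxE.
  apply/rowP => j; rewrite mxE; case: (j =P 0) => [->//|].
  by case: j => [[|[|j]] lt] // ne; [case: ne; apply: val_inj | congr (v _ _); apply: val_inj].
have m0 xy : (monic_of (h xy))`_0 = xy.1.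
  by rewrite -[0%N]/(val (0 : 'I_2)) coef_monic_of mxE.
have m1 xy : (monic_of (h xy))`_1 = xy.2.
  by rewrite -[1%N]/(val (1 : 'I_2)) coef_monic_of mxE.
have kE xy : kloos_form a (monic_of (h xy)) = xy.2 * (1 + a / xy.1).
  rewrite /kloos_form size_monic_of coefXM /= m0 m1; ring.
under eq_bigl => xy do rewrite m0.
under eq_bigr => xy _ do rewrite kE.
transitivity (\sum_(x : F | x != 0) \sum_(y : F) chi (- (b * (y * (1 + a / x))))).
  by rewrite pair_big_dep /=; apply: eq_bigl => -[x y]; rewrite /= andbT.
rewrite (bigD1 (- a)) ?oppr_eq0 //= [X in _ + X]big1 => [|x /andP[x0 xa]].
  under eq_bigr => y _ do rewrite invrN mulrN divff // subrr !mulr0 oppr0 chi0.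
  by rewrite addr0 sumr_const.
transitivity (\sum_y chi (y * (- (b * (1 + a / x))))).
  by apply: eq_bigr => y _; congr chi; ring.
rewrite sum_chi_mul oppr_eq0 mulf_eq0 (negPf b0) /=.
case: eqP => // /eqP; rewrite addr_eq0 eq_sym eqr_oppLR => /eqP e.
by case/eqP: xa; rewrite -[x]mul1r -(opprK 1) -e mulNr divfK.
Qed.

(* The coefficients of X and of X^(n-1) vary independently; shift the latter. *)
Lemma Lcoef_ge3 n : (3 <= n)%N -> c n = 0.
Proof.
case: n => // n n3; pose t := - (t0 / b).
have n0 : (0 < n)%N by apply: leq_trans (_ : 2 <= n)%N; first by [].
have n1 : (1 < n)%N by [].
pose e : 'rV[F]_n.+1 := t *: delta_mx 0 ord_max.
have mE v : monic_of (v + e) = monic_of v + t *: 'X^n.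
  by rewrite /monic_of linearD linearZ /= rVpoly_delta addrA.
have e1 : c n.+1 = chi t0 * c n.+1.
  rewrite {1}/Lcoef (reindex_inj (addIr e)) mulr_sumr; apply: eq_big => v.
    by rewrite mE coefD coefZ coefXn ltn_eqF // mulr0 addr0.
  move=> _; rewrite -chiD; congr chi; rewrite /kloos_form !size_monic_of mE !coefXM /=.
  rewrite !coefD !coefZ !coefXn eqxx !ltn_eqF // !mulr0 !addr0 mulr1.
  by set w := a * _; rewrite /t; field; rewrite b0.
apply/eqP; move/eqP: e1; rewrite -subr_eq0 -[X in X - _]mul1r -mulrBl mulf_eq0 subr_eq0 eq_sym.
by rewrite (negPf chi1).
Qed.

(** The L-function is 1 + c_1 T + q T^2 = (1 - x T)(1 - y T). For k >= 3 Newton's identity becomes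
    the recurrence K_k + c_1 K_(k-1) + q K_(k-2) = 0, which the power sums of x and y satisfy
    too. *)
Lemma kloos_ext_power_sum (L : finFieldType) (io : {rmorphism F -> L}) (B : nat) (x y : algC) :
  splits_upto io B -> x + y = - c 1 -> x * y = q%:R ->
  forall k, (0 < k < B)%N -> kloos_ext io chi a b k = - (x ^+ k + y ^+ k).
Proof.
move=> spl xDy xMy; elim/ltn_ind => -[|[|[|k]]] // IHk.
- move=> kB; have := Lcoef_newton spl a b chiD kB.
  by rewrite big_nat1 subnn Lcoef0 mulr1 mul1r => <-; rewrite !expr1 xDy opprK.
- move=> kB; have := Lcoef_newton spl a b chiD kB.
  rewrite big_nat_recr //= big_nat1 subnn Lcoef0 mulr1 (IHk 1%N) //; last first.
    by case/andP: kB => _; apply: ltn_trans.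
  rewrite !expr1 xDy opprK Lcoef2 => e.
  have -> : kloos_ext io chi a b 2 = 2%:R * q%:R - c 1 * c 1 by rewrite e; ring.
  have -> : c 1 = - (x + y) by rewrite xDy opprK.
  by rewrite -xMy; ring.
move=> kB; have := Lcoef_newton spl a b chiD kB.
have kB1 : (k.+2 < B)%N by apply: ltn_trans kB.
rewrite Lcoef_ge3 // mulr0 big_nat_recr //= big_nat_recr //= big_nat_recr //=.
rewrite subnn subSnn (_ : k.+3 - k.+1 = 2)%N; last by lia.
rewrite big_nat big1 => [|i /andP[i0 ik]]; last first.
  by rewrite (Lcoef_ge3 (n := k.+3 - i)) ?mulr0 //; lia.
rewrite Lcoef0 Lcoef2 (IHk k.+1) ?(IHk k.+2) //; last by lia.
have -> : c 1 = - (x + y) by rewrite xDy opprK.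
move/eqP; rewrite add0r mulr1 eq_sym addrC addr_eq0 => /eqP ->.
by rewrite -xMy !exprS; ring.
Qed.
End LCoefficients.

(** * Counting points on z^q - z = r + a / r *)

Lemma splits_upto_exists (F : finFieldType) (B : nat) :
  exists (L : finFieldType) (io : {rmorphism F -> L}), splits_upto io B.
Proof.
pose p : {poly F} := \prod_(v : 'rV[F]_B | rVpoly v != 0) rVpoly v.
have p0 : p != 0 by apply/prodf_neq0.
have [L [rs erp _]] := FinSplittingFieldFor p0.
exists (FinFieldExtType L), (in_alg L) => g g0 sg.
have : map_poly (in_alg L) g %| map_poly (in_alg L) p.
  rewrite dvdp_map /p (bigD1 (poly_rV g)) ?poly_rV_K //=.
  exact: dvdp_mulr.
rewrite (eqp_dvdr _ erp) => /dvdp_prod_XsubC[m em].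
by exists (mask m rs).
Qed.

Lemma mup_le1 (R : fieldType) (p : {poly R}) x : p != 0 -> ~~ root p^`() x -> (mup x p <= 1)%N.
Proof.
move=> p0; apply: contraR; rewrite -ltnNge mup_geq // => /dvdpP[g ->].
rewrite expr2 !derivM derivXsubC /root !(hornerXsubC, hornerM, hornerD).
by rewrite subrr !(mulr0, mul0r, addr0).
Qed.

Section FrobeniusFixed.
Variables (F L : finFieldType) (io : {rmorphism F -> L}) (B : nat).
Hypothesis spl : splits_upto io B.
Hypothesis ch2 : 2%N \notin [pchar F].
Local Notation q := #|F|.

Lemma card_nat_eq0 : q%:R = 0 :> L.
Proof.
have [p p_pr cp] := finPcharP F.
have : (p %| q)%N.
  rewrite (card_pprimeChar cp); apply: dvdn_exp => //.
  rewrite lt0n; apply: contraTneq (finNzRing_gt1 F) => e.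
  by rewrite (card_pprimeChar cp) e.
by move=> /dvdnP[m ->]; rewrite natrM (pcharf0 (_ : p \in [pchar L])) ?mulr0 // (fmorph_pchar io).
Qed.

Lemma two_neq0 : (2%:R : L) != 0.
Proof.
apply: contra ch2 => e; rewrite -(fmorph_pchar io) inE /=.
by rewrite e.
Qed.

Lemma odd_card : odd q.
Proof.
have [p p_pr cp] := finPcharP F.
rewrite (card_pprimeChar cp) oddX; apply/orP; right.
by case: (even_prime p_pr) => // e; rewrite e (negPf ch2) in cp.
Qed.

Lemma card_frob_fixed k : (0 < k)%N -> (q ^ k < B)%N ->
  #|[set r : L | r ^+ (q ^ k) == r]| = (q ^ k)%N.
Proof.
move=> k0 kB; set Q := (q ^ k)%N.
have Q1 : (1 < Q)%N by rewrite -(expn0 q) ltn_exp2l // finNzRing_gt1.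
pose g : {poly F} := 'X^Q - 'X.
have sg : size g = Q.+1 by rewrite size_polyDl size_polyXn // size_polyN size_polyX.
have gm : g \is monic.
  rewrite monicE lead_coefE sg /= coefB coefXn coefX eqxx gtn_eqF // subr0 //.
have [|rs] := spl (monic_neq0 gm); first by rewrite sg.
rewrite eqp_monic ?map_monic ?monic_prod_XsubC // => /eqP eg.
have gE : map_poly io g = 'X^Q - 'X by rewrite rmorphB /= map_polyXn map_polyX.
have szr : size rs = Q by apply: succn_inj; rewrite -sg -(size_map_poly io) eg size_prod_XsubC.
have urs : uniq rs.
  rewrite -separable_prod_XsubC -eg gE separable_poly.unlock derivB derivXn derivX.
  have QL : Q%:R = 0 :> L by rewrite /Q natrX card_nat_eq0 expr0n gtn_eqF.
  by rewrite -scaler_nat QL scale0r sub0r -[- 1]scaleN1r coprimepZr ?oppr_eq0 ?oner_eq0 // coprimep1.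
rewrite -[RHS]szr -(card_uniqP urs); apply: eq_card => r.
by rewrite inE -root_prod_XsubC -eg gE /root !hornerE subr_eq0.
Qed.

(** [splits_upto] only speaks of polynomials over F, whereas w lies in L. But X^2 - w divides X^(2Q)
    - X^2, the composition of X^Q - X with X^2, and this one is over F. *)
Lemma sqrt_in_frob_fixed k (w : L) : (0 < k)%N -> (2 * q ^ k < B)%N ->
  w != 0 -> w ^+ (q ^ k) = w -> exists s, s ^+ 2 = w.
Proof.
move=> k0 kB w0 wk; set Q := (q ^ k)%N.
have Q1 : (1 < Q)%N by rewrite -(expn0 q) ltn_exp2l // finNzRing_gt1.
pose g : {poly F} := 'X^(2 * Q) - 'X^2.
have sg : size g = (2 * Q).+1.
  by rewrite size_polyDl size_polyXn // size_polyN size_polyXn ltnS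
    -[X in (X < _)%N]muln1 ltn_pmul2l.
have [||rs] := spl (p := g); rewrite -?size_poly_eq0 ?sg // => eg.
have gE : map_poly io g = ('X^Q - 'X) \Po 'X^2.
  by rewrite rmorphB /= !map_polyXn comp_polyB comp_polyX comp_Xn_poly -exprM.
have : 'X^2 - w%:P %| map_poly io g.
  have : 'X - w%:P %| 'X^Q - 'X by rewrite dvdp_XsubCl /root !hornerE wk subrr.
  move=> /dvdpP[u eu]; rewrite gE eu comp_polyM dvdp_mull //.
  by rewrite comp_polyB comp_polyX comp_polyC.
rewrite (eqp_dvdr _ eg) => /dvdp_prod_XsubC[m em].
have sz : size ('X^2 - w%:P) = 3.
  by rewrite size_polyDl size_polyXn // size_polyN size_polyC w0.
case e : (mask m rs) em => [|s l] em.
  by have := eqp_size em; rewrite sz big_nil size_poly1.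
exists s; have : root ('X^2 - w%:P) s by rewrite (eqp_root em) root_prod_XsubC mem_head.
by rewrite /root !hornerE subr_eq0 => /eqP.
Qed.
End FrobeniusFixed.

Section ArtinSchreierCurve.
Variables (F L : finFieldType) (io : {rmorphism F -> L}) (B : nat).
Hypothesis spl : splits_upto io B.
Hypothesis ch2 : 2%N \notin [pchar F].
Variable a : F.
Hypothesis a0 : a != 0.
Local Notation q := #|F|.

(** For m = q and c = a, this is the discriminant of r^2 - (y^q - y) r + a, the equation y^q - y = r
    + a / r cleared of its denominator, as a polynomial in y. *)
Definition disc_poly (R : nzRingType) (m : nat) (c : R) : {poly R} :=
  ('X^m - 'X) ^+ 2 - (4%:R * c)%:P.

Lemma disc_poly_map : map_poly io (disc_poly q a) = disc_poly q (io a).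
Proof.
rewrite /disc_poly rmorphB rmorphXn rmorphB /= map_polyXn map_polyX map_polyC /=.
by rewrite rmorphM rmorph_nat.
Qed.

Lemma horner_disc_poly y : (disc_poly q (io a)).[y] = (y ^+ q - y) ^+ 2 - 4%:R * io a.
Proof. by rewrite /disc_poly !(hornerXn, hornerX, hornerC, hornerD, hornerN, horner_exp). Qed.

Lemma size_disc_poly : size (disc_poly q a) = (2 * q).+1.
Proof.
have q1 := finNzRing_gt1 F.
have sX : size ('X^q - 'X : {poly F}) = q.+1.
  by rewrite size_polyDl size_polyXn // size_polyN size_polyX.
have sX2 : size (('X^q - 'X) ^+ 2 : {poly F}) = (2 * q).+1.
  rewrite -[LHS]prednK; first by rewrite size_exp sX /= mulnC.
  by rewrite size_poly_gt0 expf_neq0 // -size_poly_eq0 sX.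
rewrite /disc_poly size_polyDl sX2 // size_polyN.
by apply: leq_ltn_trans (size_polyC_leq1 _) _; rewrite ltnS muln_gt0 (ltnW q1).
Qed.

Lemma four_a_neq0 : 4%:R * io a != 0.
Proof.
have n2 := two_neq0 io ch2.
by rewrite mulf_neq0 ?fmorph_eq0 // (natrM _ 2 2) mulf_neq0.
Qed.

(** Any root is simple: the derivative is - 2 (y^q - y), and (y^q - y)^2 = 4 a is nonzero at a
    root. *)
Lemma disc_poly_root : (2 * q < B)%N -> exists rho, mup rho (disc_poly q (io a)) = 1%N.
Proof.
move=> qB; set f := disc_poly q (io a).
have f0 : disc_poly q a != 0 by rewrite -size_poly_eq0 size_disc_poly.
have fn0 : f != 0 by rewrite /f -disc_poly_map map_poly_eq0.
have [|rs] := spl f0; first by rewrite size_disc_poly.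
rewrite disc_poly_map -/f; case: rs => [|rho rs] e.
  have := eqp_size e; rewrite big_nil size_poly1 /f -disc_poly_map size_map_poly size_disc_poly.
  by have q1 : (1 < q)%N := finNzRing_gt1 F; rewrite mul2n; case: (q) q1.
exists rho; have rf : root f rho by rewrite (eqp_root e) root_prod_XsubC mem_head.
apply/eqP; rewrite eqn_leq -XsubC_dvd // dvdp_XsubCl rf andbT.
apply: mup_le1 => //; rewrite /f /disc_poly expr2 derivB derivC subr0 derivM derivB derivXn derivX.
rewrite /root !(hornerXn, hornerX, hornerC, hornerD, hornerN, hornerM, hornerMn).
rewrite -[X in X - 1]mulr_natl (card_nat_eq0 io) mul0r sub0r.
move: rf; rewrite /root horner_disc_poly subr_eq0 => /eqP rf.
rewrite mulrN1 mulN1r -opprD oppr_eq0 -mulr2n -mulr_natl mulf_neq0 ?(two_neq0 io) //.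
by apply: contraTneq four_a_neq0 => e0; rewrite -rf e0 expr0n eqxx.
Qed.

Lemma card_artin_schreier_fiber (w : L) : (#|[set y : L | (y ^+ q - y == w)%R]| <= q)%N.
Proof.
have q1 := finNzRing_gt1 F.
set S := [set y | _]; pose g : {poly L} := 'X^q - ('X + w%:P).
have sg : size g = q.+1.
  by rewrite size_polyDl size_polyXn // size_polyN size_XaddC.
rewrite cardE -ltnS -sg; apply: max_poly_roots (enum_uniq _).
  by rewrite -size_poly_eq0 sg.
apply/allP => y; rewrite mem_enum inE => /eqP e.
by rewrite /root /g !(hornerXn, hornerX, hornerC, hornerD, hornerN) -e; apply/eqP; ring.
Qed.

(** The easy half of the additive Hilbert 90: the trace of y^q - y telescopes. *)
Lemma ext_trace_artin_schreier k r y : r ^+ (q ^ k) = r -> y ^+ (q ^ k) = y ->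
  y ^+ q - y = r + io a / r -> ext_trace io a k r = 0.
Proof.
move=> rk yk e; apply: (fmorph_inj io); rewrite ext_traceE // rmorph0 -e.
under eq_bigr => i _ do rewrite exprB_pchar ?(card_pchar_nat io) // -exprM -expnS.
rewrite -(big_mkord xpredT (fun i => y ^+ (q ^ i.+1) - y ^+ (q ^ i))) telescope_sumr //.
by rewrite yk expr1 subrr.
Qed.

(** The hypothesis is Euler's criterion for the discriminant w = u^2 - 4 a. A square root s of w
    satisfies s^Q = s w^((Q-1)/2) = s, so the two roots (u + s)/2 and (u - s)/2 are fixed by the
    Q-th power. *)
Lemma artin_schreier_two_solutions k y : (0 < k)%N -> (2 * q ^ k < B)%N -> y ^+ (q ^ k) = y ->
  (disc_poly q (io a)).[y] ^+ (q ^ k).-1./2 = 1 ->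
  (2 <= #|[set r : L | [&& r != 0, r ^+ (q ^ k) == r & y ^+ q - y == r + io a / r]%R]|)%N.
Proof.
move=> k0 kB yk; rewrite horner_disc_poly; set u := y ^+ q - y; set w := u ^+ 2 - _ => w1.
set Q := (q ^ k)%N in kB yk w1 *.
have cQ : [pchar L].-nat Q := card_pchar_nat io k.
have oQ : odd Q by rewrite oddX odd_card ?orbT.
have fixn n : n%:R ^+ Q = n%:R :> L.
  elim: n => [|n IHn]; first by rewrite expr0n gtn_eqF ?odd_gt0.
  by rewrite -natr1 exprDn_pchar // IHn expr1n.
have fixa : io a ^+ Q = io a.
  by rewrite /Q; elim: (k) => [|m IHm]; rewrite ?expr1 // expnSr exprM IHm io_frob.
have fixu : u ^+ Q = u by rewrite /u exprB_pchar // exprAC yk.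
have fixw : w ^+ Q = w by rewrite /w exprB_pchar // exprAC fixu exprMn fixa fixn.
(* Since 0^0 = 1, w = 0 is compatible with the hypothesis only if (Q-1)/2 = 0; an odd q > 1 rules
   this out. *)
have w0 : w != 0.
  apply/eqP => w00; move: w1; rewrite w00 expr0n.
  case: (Q.-1./2 =P 0%N) => [e _|_ /esym/eqP]; last by rewrite oner_eq0.
  have q1 : (1 < q)%N := finNzRing_gt1 F; have : (Q < 3)%N by move: e oQ; clear; lia.
  have : (q <= Q)%N by rewrite -{1}[q]expn1 leq_pexp2l // ltnW ?finNzRing_gt1.
  by have := odd_card ch2; lia.
have [s sw] := sqrt_in_frob_fixed spl k0 kB w0 fixw.
have s0 : s != 0 by apply: contraNneq w0 => s0; rewrite -sw s0 expr0n.
have fixs : s ^+ Q = s.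
  rewrite -(odd_double_half Q) oQ add1n exprS -muln2 mulnC exprM sw.
  suff -> : Q./2 = (Q.-1)./2 by rewrite w1 mulr1.
  by move: oQ; clear; lia.
have n2 := two_neq0 io ch2.
pose r1 := (u + s) / 2%:R; pose r2 := (u - s) / 2%:R.
have r12 : r1 * r2 = io a.
  have e4 : 4%:R * (r1 * r2) = 4%:R * io a.
    transitivity (u ^+ 2 - s ^+ 2); first by rewrite /r1 /r2; field.
    by rewrite sw /w; ring.
  by apply: (mulfI (_ : 4%:R != 0)) e4; rewrite (natrM _ 2 2) mulf_neq0.
have r1D2 : r1 + r2 = u by rewrite /r1 /r2; field.
have [r10 r20] : r1 != 0 /\ r2 != 0.
  by apply/andP; rewrite -negb_or -mulf_eq0 r12 fmorph_eq0.
have ne12 : r1 != r2.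
  rewrite -subr_eq0; have -> : r1 - r2 = s by rewrite /r1 /r2; field.
  by [].
have -> : 2%N = #|[set r1; r2]| by rewrite cards2 ne12.
apply/subset_leq_card/subsetP => r; rewrite !inE => /orP[] /eqP ->.
  rewrite r10 -r12 mulrAC divff // mul1r r1D2 eqxx andbT /=.
  by rewrite /r1 expr_div_n exprDn_pchar // fixu fixs fixn.
rewrite r20 -r12 mulfK // addrC r1D2 eqxx andbT /=.
by rewrite /r2 expr_div_n exprB_pchar // fixu fixs fixn.
Qed.

End ArtinSchreierCurve.

Section ArtinSchreierCount.
Variables (F L : finFieldType) (io : {rmorphism F -> L}) (B : nat).
Hypothesis spl : splits_upto io B.
Hypothesis ch2 : 2%N \notin [pchar F].
Variable a : F.
Hypothesis a0 : a != 0.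
Local Notation q := #|F|.

(** Stepanov's bound is applied to the value -1 of f(y)^((Q-1)/2), with D = 2 q and P = q^h. The
    zeros of f being at most 2 q, about half of the Q points y at least take the value 1. Each of
    these gives two r of trace 0, and each r arises from at most q points y, whence q |R| >= 2 |S1|
    >= Q - 4 q P - 4 q. *)
Lemma card_trace0_ge (h : nat) : ((2 * q) ^ 2 < q ^ h)%N -> (2 * q ^ (2 * h) < B)%N ->
  (q ^ (2 * h) <=
    q * #|[set r : L | [&& r != 0, r ^+ (q ^ (2 * h)) == r & ext_trace io a (2 * h) r == 0]%R]|
    + 8 * q * q ^ h)%N.
Proof.
move=> hq hB; set R := [set r | _]; set P := (q ^ h)%N in hq *.
have eQ : (q ^ (2 * h))%N = (P ^ 2)%N by rewrite /P -expnM mulnC.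
have q1 : (1 < q)%N := finNzRing_gt1 F.
have q0 : (0 < q)%N := ltnW q1.
have leqP : (2 * q < P)%N by apply: leq_ltn_trans hq; rewrite -mulnn leq_pmulr // muln_gt0.
have P1 : (1 < P)%N by apply: leq_ltn_trans leqP; rewrite muln_gt0.
have h0 : (0 < 2 * h)%N.
  rewrite muln_gt0 /= lt0n; apply/eqP => e; move: P1.
  by rewrite /P e expn0.
have PQ : (P <= P ^ 2)%N by rewrite -{1}[P]expn1 leq_pexp2l // ltnW.
have qB : (2 * q < B)%N by apply: ltn_trans hB; rewrite eQ; lia.
have QB : (q ^ (2 * h) < B)%N by apply: leq_ltn_trans hB; lia.
have [rho mr] := disc_poly_root spl ch2 a0 qB.
set f := disc_poly q (io a) in mr *.
have sf : size f = (2 * q).+1 by rewrite /f -disc_poly_map size_map_poly size_disc_poly.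
have cP : [pchar L].-nat P := card_pchar_nat io h.
have oddP : odd P by rewrite oddX odd_card ?orbT.
have f00 : f.[0] != 0.
  by rewrite horner_disc_poly expr0n gtn_eqF // subrr expr0n sub0r oppr_eq0 four_a_neq0.
have evD : ~~ odd (2 * q) by rewrite mul2n odd_double.
have step := stepanov_bound cP oddP evD hq sf f00 mr.
set S := [set y | _] in step.
set Q := (q ^ (2 * h))%N in eQ hB QB *.
have cQ : [pchar L].-nat Q := card_pchar_nat io (2 * h).
pose Y := [set y : L | y ^+ Q == y].
have cY : #|Y| = Q by apply: (card_frob_fixed spl).
pose Z := [set y : L | root f y].
have cZ : (#|Z| <= 2 * q)%N.
  rewrite cardE -ltnS -sf; apply: max_poly_roots (enum_uniq _).
    by rewrite -size_poly_eq0 sf.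
  by apply/allP => y; rewrite mem_enum inE.
pose S1 := [set y : L | (y ^+ Q == y) && (f.[y] ^+ Q.-1./2 == 1)].
have YS : (Q <= #|S| + #|Z| + #|S1|)%N.
  rewrite -cY; apply: leq_trans (_ : #|S :|: Z :|: S1| <= _)%N; last first.
    by apply: leq_trans (leq_card_setU _ _) _; rewrite leq_add2r leq_card_setU.
  apply/subset_leq_card/subsetP => y; rewrite !inE -eQ => /eqP yQ; rewrite yQ eqxx /=.
  have [_|ny] := boolP (root f y); first by rewrite orbT.
  rewrite /root in ny.
  have : f.[y] ^+ Q.-1./2 ^+ 2 == 1.
    have fQ : f.[y] ^+ Q = f.[y].
      rewrite horner_disc_poly exprB_pchar // exprAC (exprB_pchar _ _ cQ) exprAC yQ; congr (_ - _).
      have ioQ x : io x ^+ Q = io x.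
        by rewrite /Q; elim: (2 * h)%N => [|m IHm]; rewrite ?expr1 // expnSr exprM IHm io_frob.
      by rewrite -(rmorph_nat io) -rmorphM ioQ.
    rewrite -exprM muln2 halfK.
    have -> : odd Q.-1 = false.
      rewrite eQ; move: oddP PQ P1; rewrite -mulnn; clear; case: (P) => // p.
      by rewrite mulSn /= oddD oddM /= => /negPf ->.
    rewrite subn0 -(inj_eq (mulfI ny)) -exprS prednK ?fQ ?mulr1 //.
    by rewrite eQ expn_gt0 ltnW.
  by rewrite sqrf_eq1 => /orP[] ->; rewrite ?orbT.
have main : (2 * #|S1| <= q * #|R|)%N.
  pose T r y := [&& r != 0, r ^+ Q == r, y ^+ Q == y & y ^+ q - y == r + io a / r].
  apply: leq_trans (_ : \sum_(y : L) \sum_(r : L) T r y <= _)%N.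
    rewrite mulnC -sum_nat_const big_mkcond; apply: leq_sum => y _ /=.
    case: ifP => //; rewrite inE => /andP[/eqP yQ /eqP y1].
    apply: leq_trans (artin_schreier_two_solutions spl ch2 a0 h0 hB yQ y1) _.
    rewrite -sum1_card big_mkcond; apply: leq_sum => r _; rewrite inE /T yQ eqxx /=.
    by rewrite -/Q; case: ifP.
  rewrite exchange_big mulnC -sum_nat_const [X in (_ <= X)%N]big_mkcond; apply: leq_sum => r _ /=.
  case: ifP => rR.
    apply: leq_trans (card_artin_schreier_fiber F (r + io a / r)).
    rewrite -sum1_card [X in (_ <= X)%N]big_mkcond; apply: leq_sum => y _; rewrite inE /T.
    by case: (_ != 0); case: (r ^+ Q == r); case: (y ^+ Q == y); case: (_ == _).
  rewrite big1 // => y _; rewrite /T; apply/eqP; rewrite eqb0; apply/negP.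
  case/and4P=> r0 /eqP rQ /eqP yQ /eqP e; case/negP: (negbT rR).
  by rewrite inE r0 rQ eqxx (ext_trace_artin_schreier rQ yQ e) eqxx.
rewrite -eQ in step; nia.
Qed.

End ArtinSchreierCount.

(** * Weil's bound for Kloosterman sums *)

(* For e = 1 and e = -1, the roots of X^2 + K X + m. *)
Definition quad_root (K m : algC) (e : algC) : algC := (- K + e * sqrtC (K ^+ 2 - 4%:R * m)) / 2%:R.

Lemma quad_root_sum K m : quad_root K m 1 + quad_root K m (-1) = - K.
Proof. by rewrite /quad_root; field. Qed.

Lemma quad_root_mul K m : quad_root K m 1 * quad_root K m (-1) = m.
Proof.
rewrite /quad_root; set s := sqrtC _.
transitivity ((K ^+ 2 - s ^+ 2) / 4%:R); first by field.
by rewrite /s sqrtCK; field.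
Qed.

(** Real roots have nonnegative even powers; otherwise the roots are complex conjugates, both of
    squared modulus m. *)
Lemma quad_root_power_ge K m h : K \is Num.real -> 0 <= m ->
  - (2%:R * m ^+ h) <= quad_root K m 1 ^+ (2 * h) + quad_root K m (-1) ^+ (2 * h).
Proof.
move=> rK m0; set x := quad_root K m 1; set y := quad_root K m (-1).
have mR : m \is Num.real by apply: ger0_real.
have dR : K ^+ 2 - 4%:R * m \is Num.real by rewrite rpredB ?rpredX ?rpredM ?realn.
set s := sqrtC (K ^+ 2 - 4%:R * m).
have [d0|d0] := real_leP (real0 _) dR.
  have sR : s \is Num.real by apply: ger0_real; rewrite sqrtC_ge0.
  have xR e : e \is Num.real -> quad_root K m e \is Num.real.
    by move=> eR; rewrite /quad_root rpredM ?rpredV ?realn // rpredD ?rpredN ?rpredM.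
  apply: (le_trans (y := 0)); first by rewrite oppr_le0 mulr_ge0 ?exprn_ge0 ?ler0n.
  by rewrite !exprM addr_ge0 // exprn_ge0 // real_exprn_even_ge0 // xR ?rpredN ?real1.
have sC : s^* = - s.
  have : s^* ^+ 2 == s ^+ 2 by rewrite -rmorphXn /s sqrtCK; apply/eqP/CrealP.
  rewrite eqf_sqr => /orP[/eqP sC|/eqP //].
  have : 0 <= s ^+ 2 by rewrite real_exprn_even_ge0 //; apply/CrealP.
  by rewrite /s sqrtCK => /(lt_le_trans d0); rewrite ltxx.
have xC : x^* = y.
  rewrite /x /y /quad_root rmorphM rmorphD rmorphN rmorphM fmorphV rmorph_nat rmorph1 /= -/s sC.
  by rewrite (CrealP rK) mul1r mulN1r.
have yC : y^* = x by rewrite -xC conjCK.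
have xy : x * y = m by apply: quad_root_mul.
have VR : x ^+ (2 * h) + y ^+ (2 * h) \is Num.real.
  by apply/CrealP; rewrite rmorphD !rmorphXn /= xC yC addrC.
have nx : `|x| ^+ 2 = m by rewrite normCK xC.
have ny : `|y| ^+ 2 = m by rewrite normCK yC mulrC.
have : `|x ^+ (2 * h) + y ^+ (2 * h)| <= 2%:R * m ^+ h.
  apply: le_trans (ler_normD _ _) _; rewrite !normrX !exprM nx ny.
  by rewrite mulr_natl.
by rewrite real_ler_norml // => /andP[].
Qed.

(** The roots are real and their squares add up to K^2 - 2 m > 2 m, so one of the squares exceeds m
    and serves as [theta]. *)
Lemma quad_root_power_growth K m : K \is Num.real -> 0 <= m -> 4%:R * m < K ^+ 2 ->
  exists2 theta, m < theta &
    forall h, theta ^+ h <= quad_root K m 1 ^+ (2 * h) + quad_root K m (-1) ^+ (2 * h).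
Proof.
move=> rK m0 Km; set x := quad_root K m 1; set y := quad_root K m (-1).
have sR : sqrtC (K ^+ 2 - 4%:R * m) \is Num.real.
  by apply: ger0_real; rewrite sqrtC_ge0 subr_ge0 ltW.
have xR e : e \is Num.real -> quad_root K m e \is Num.real.
  by move=> eR; rewrite /quad_root rpredM ?rpredV ?realn // rpredD ?rpredN ?rpredM.
have {}xR : x \is Num.real by apply: xR; apply: real1.
have yR : y \is Num.real.
  by rewrite /y /quad_root rpredM ?rpredV ?realn // rpredD ?rpredN ?rpredM ?rpredN ?real1.
have x20 : 0 <= x ^+ 2 by rewrite real_exprn_even_ge0.
have y20 : 0 <= y ^+ 2 by rewrite real_exprn_even_ge0.
have e : x ^+ 2 + y ^+ 2 = K ^+ 2 - 2%:R * m.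
  have xDy : x + y = - K := quad_root_sum K m.
  have xMy : x * y = m := quad_root_mul K m.
  rewrite -xMy -(opprK K) -xDy; ring.
have mR : m \is Num.real by apply: ger0_real.
have [mx|xm] := real_ltP mR (ger0_real x20).
  by exists (x ^+ 2) => // h; rewrite !exprM lerDl exprn_ge0.
exists (y ^+ 2); last by move=> h; rewrite !exprM lerDr exprn_ge0.
rewrite -(ltrD2l (x ^+ 2)) e; apply: le_lt_trans (_ : m + m < _); first by rewrite lerD2r.
rewrite ltrBrDr; apply: le_lt_trans Km; rewrite le_eqVlt; apply/orP; left; apply/eqP; ring.
Qed.

Lemma bernoulli (R : numDomainType) (e : R) n : 0 <= e -> 1 + e *+ n <= (1 + e) ^+ n.
Proof.
move=> e0; elim: n => [|n IHn]; first by rewrite mulr0n addr0.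
rewrite exprS; apply: le_trans (ler_wpM2l _ IHn); last by rewrite addr_ge0 ?ler01.
rewrite -subr_ge0 (_ : _ - _ = e * (e *+ n)) ?mulr_ge0 ?mulrn_wge0 //.
by rewrite mulrS; ring.
Qed.

Lemma exp_growth (m theta C : algC) h0 : 1 <= m -> m < theta ->
  (forall h, (h0 <= h)%N -> theta ^+ h <= C * m ^+ h) -> False.
Proof.
move=> m1 mt H; have m0 : 0 < m by apply: lt_le_trans m1.
pose e := theta / m - 1.
have e0 : 0 < e by rewrite subr_gt0 ltr_pdivlMr // mul1r.
have H2 h : (h0 <= h)%N -> e *+ h <= C.
  move=> hh; apply: le_trans (_ : (1 + e) ^+ h <= _).
    by apply: le_trans (bernoulli h (ltW e0)); rewrite lerDr ler01.
  rewrite /e addrC subrK expr_div_n ler_pdivrMr ?exprn_gt0 //; exact: H.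
have C0 : 0 <= C by apply: le_trans (H2 h0 _); rewrite ?mulrn_wge0 // ltW.
have Ce0 : 0 <= C / e by rewrite divr_ge0 // ltW.
have := archi_boundP Ce0; set N := Num.bound _ => ltN.
have := H2 (h0 + N)%N (leq_addr _ _); rewrite -mulr_natr mulrC -ler_pdivlMr //.
move=> le; have le2 : N%:R <= C / e by apply: le_trans le; rewrite ler_nat leq_addl.
by have := lt_le_trans ltN le2; rewrite ltxx.
Qed.

Section Weil.
Variables (F : finFieldType) (chi : F -> algC) (t0 : F).
Hypothesis ch2 : 2%N \notin [pchar F].
Hypothesis chiD : forall x y, chi (x + y) = chi x * chi y.
Hypothesis chi0 : chi 0 = 1.
Hypothesis chi_norm : forall x, `|chi x| = 1.
Hypothesis chi1 : chi t0 != 1.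
Local Notation q := #|F|.

Lemma conj_chi x : (chi x)^* = chi (- x).
Proof.
have n0 : chi x != 0 by rewrite -normr_eq0 chi_norm oner_eq0.
apply: (mulfI n0); rewrite -normCK chi_norm expr1n -chiD subrr chi0 //.
Qed.

Definition kloosterman (a b : F) : algC := \sum_(x : F | x != 0) chi (b * (x + a / x)).

Lemma kloosterman_real a b : kloosterman a b \is Num.real.
Proof.
apply/CrealP; rewrite rmorph_sum /= (reindex_inj oppr_inj) /=.
apply: eq_big => [x|x _]; first by rewrite oppr_eq0.
by rewrite conj_chi invrN mulrN -opprD mulrN opprK.
Qed.

(** By orthogonality the K_k(b) sum over all b to q times the number of r of trace 0, which
    [card_trace0_ge] bounds below. The term b = 0, equal to q^k - 1, is removed because the
    L-function computation requires b != 0. *)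
Lemma sum_kloosterman_power a h : a != 0 -> ((2 * q) ^ 2 < q ^ h)%N ->
  \sum_(b : F | b != 0) (quad_root (kloosterman a b) q%:R 1 ^+ (2 * h)
                         + quad_root (kloosterman a b) q%:R (-1) ^+ (2 * h))
  <= 8%:R * q%:R * q%:R ^+ h.
Proof.
move=> a0 hq; have q1 : (1 < q)%N := finNzRing_gt1 F.
have h0 : (0 < h)%N.
  by case: h hq => //; rewrite expn0 ltnS leqn0 gtn_eqF // expn_gt0 muln_gt0 (ltnW q1).
set k := (2 * h)%N; have k0 : (0 < k)%N by rewrite muln_gt0.
have [L [io spl]] := splits_upto_exists F (2 * q ^ k).+1.
have QB : (2 * q ^ k < (2 * q ^ k).+1)%N by [].
have kB : (0 < k < (2 * q ^ k).+1)%N.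
  rewrite k0 ltnS; apply: leq_trans (_ : q ^ k <= _)%N; last by rewrite leq_pmull.
  exact/ltnW/ltn_expl.
have Q1B : (q ^ k < (2 * q ^ k).+1)%N by rewrite ltnS leq_pmull.
set R := [set r : L | [&& r != 0, r ^+ (q ^ k) == r & ext_trace io a k r == 0]].
have step : (q ^ k <= q * #|R| + 8 * q * q ^ h)%N := card_trace0_ge spl ch2 a0 hq QB.
have e1 : \sum_(b : F | b != 0) (quad_root (kloosterman a b) q%:R 1 ^+ k
                         + quad_root (kloosterman a b) q%:R (-1) ^+ k)
   = - \sum_(b : F | b != 0) kloos_ext io chi a b k.
  rewrite -sumrN; apply: eq_bigr => b b0.
  have xMy := quad_root_mul (kloosterman a b) q%:R.
  rewrite (kloos_ext_power_sum chiD chi0 chi1 a0 b0 spl _ xMy kB) ?opprK //.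
  by rewrite quad_root_sum (Lcoef1 chi a b).
rewrite e1.
have e2 : \sum_(b : F) kloos_ext io chi a b k = (q * #|R|)%:R.
  rewrite exchange_big /= natrM mulrC mulr_natl -sumr_const [RHS]big_mkcond [LHS]big_mkcond.
  apply: eq_bigr => r _; rewrite inE.
  case: (r != 0) => //=; case: (r ^+ (q ^ k) == r) => //=.
  exact: (sum_chi_mul chiD chi0 chi1).
have e3 : kloos_ext io chi a 0 k = (q ^ k)%:R - 1.
  rewrite -(card_frob_fixed spl k0 Q1B) (cardD1 0) inE expr0n gtn_eqF ?expn_gt0 ?(ltnW q1) //.
  rewrite eqxx add1n -natr1 addrK -sumr_const.
  by apply: eq_big => [r|r _]; rewrite ?mul0r // !inE.
move: e2; rewrite (bigD1 0) //= e3 => /eqP; rewrite eq_sym addrC -subr_eq => /eqP <-.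
rewrite opprB lerBlDr; apply: le_trans (_ : (q ^ k)%:R <= _).
  by rewrite lerBlDr lerDl ler01.
by rewrite addrC -natrX -!natrM -natrD ler_nat.
Qed.

(** The terms of index other than b add up to at least - 2 q q^h, so the term of b is at most (8 q +
    2 q) q^h. If K^2 > 4 q it would grow like [theta]^h with [theta] > q. *)
Lemma kloosterman_bound a b : a != 0 -> b != 0 -> kloosterman a b ^+ 2 <= 4%:R * q%:R.
Proof.
move=> a0 b0; have q1 : (1 < q)%N := finNzRing_gt1 F.
have KR := kloosterman_real a b; set K := kloosterman a b in KR *.
have mR : 4%:R * q%:R \is @Num.real algC by rewrite rpredM ?realn.
have [//|Kbig] := real_leP (rpredX 2 KR) mR.
have [theta qt H] := quad_root_power_growth KR (ler0n _ q) Kbig.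
exfalso; apply: (@exp_growth q%:R theta (10%:R * q%:R) ((2 * q) ^ 2) _ qt).
  by rewrite ler1n ltnW.
move=> h hh; have hq : ((2 * q) ^ 2 < q ^ h)%N.
  by apply: leq_ltn_trans hh _; apply: ltn_expl.
have := sum_kloosterman_power a0 hq; rewrite (bigD1 b) //= -/K => le.
apply: le_trans (H h) _.
have ge : - (2%:R * q%:R * q%:R ^+ h) <= \sum_(i : F | (i != 0) && (i != b))
    (quad_root (kloosterman a i) q%:R 1 ^+ (2 * h)
     + quad_root (kloosterman a i) q%:R (-1) ^+ (2 * h)).
  apply: le_trans (_ : \sum_(i : F | (i != 0) && (i != b)) - (2%:R * q%:R ^+ h) <= _); last first.
    by apply: ler_sum => i _; apply: quad_root_power_ge; rewrite ?kloosterman_real ?ler0n.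
  rewrite sumr_const mulNrn lerN2 -[X in X <= _]mulr_natr mulrAC ler_wpM2r ?exprn_ge0 ?ler0n //.
  by rewrite ler_wpM2l ?ler0n // ler_nat max_card.
have -> : 10%:R * q%:R * q%:R ^+ h
  = 8%:R * q%:R * q%:R ^+ h - - (2%:R * q%:R * q%:R ^+ h) :> algC by ring.
rewrite lerBrDr; apply: le_trans le; rewrite lerD2l //.
Qed.
End Weil.

(** * Gauss and Salie sums *)

(** The kernels of the linear characters of a group meet in its derived subgroup, trivial here; so
    some linear character of the additive group is nontrivial at the field element 1. *)
Lemma exists_additive_character (F : finFieldType) : exists (chi : F -> algC) (t0 : F),
  [/\ forall x y, chi (x + y) = chi x * chi y, chi 0 = 1, forall x, `|chi x| = 1 & chi t0 != 1].
Proof.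
pose G := [set: F]%G.
have : (1 : F) \notin G^`(1)%g.
  have /eqP -> : (G^`(1) == 1)%g by rewrite (sameP eqP derG1P) FinRing.Theory.zmod_abelian.
  by rewrite inE oner_neq0.
rewrite -cap_cfker_lin_irr => nin.
have [i lin_i ni] : exists2 i, 'chi[G]_i \is a linear_char & (1 : F) \notin cfker 'chi_i.
  apply/exists_inP; apply: contraR nin; rewrite negb_exists_in => /forall_inP H.
  by apply/bigcapP => i /H; rewrite negbK.
exists 'chi_i, 1; split.
- by move=> x y; rewrite -lin_charM ?inE.
- exact: lin_char1.
- by move=> x; rewrite normC_lin_char ?inE.
apply: contraNneq ni => e1; rewrite cfkerEchar ?irr_char // inE in_setT /=.
by rewrite e1 lin_char1.
Qed.

Definition quad_char (F : finFieldType) (x : F) : algC :=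
  if x == 0 then 0 else if [exists s : F, s ^+ 2 == x] then 1 else -1.

Section QuadChar.
Variable F : finFieldType.
Hypothesis ch2 : 2%N \notin [pchar F].
Local Notation q := #|F|.
Local Notation eta := (@quad_char F).

Lemma char_two_neq0 : (2%:R : F) != 0.
Proof. by apply: contra ch2 => e; rewrite inE /= e. Qed.

Lemma quad_char0 : eta 0 = 0. Proof. by rewrite /quad_char eqxx. Qed.

Lemma quad_charX2 (s : F) : s != 0 -> eta (s ^+ 2) = 1.
Proof.
move=> s0; rewrite /quad_char expf_eq0 (negPf s0) /=.
by case: existsP => // -[]; exists s.
Qed.

Lemma quad_char1 : eta 1 = 1. Proof. by rewrite -(expr1n _ 2) quad_charX2 ?oner_neq0. Qed.

Lemma quad_charP (x : F) : x != 0 ->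
  (exists2 s, s != 0 & x = s ^+ 2) /\ eta x = 1
  \/ (forall s, s ^+ 2 != x) /\ eta x = -1.
Proof.
move=> x0; rewrite /quad_char (negPf x0); case: existsP => [[s /eqP e]|ns].
  by left; split=> //; exists s => //; apply: contraNneq x0 => s0; rewrite -e s0 expr0n.
by right; split=> // s; apply/negP => e; apply: ns; exists s.
Qed.

Lemma quad_char_sqr (x : F) : x != 0 -> eta x ^+ 2 = 1.
Proof. by case/quad_charP=> -[_ ->]; rewrite ?sqrrN expr1n. Qed.

Lemma card_sqrt (x : F) : (#|[set s : F | s ^+ 2 == x]|)%:R = 1 + eta x.
Proof.
have [->|x0] := eqVneq x 0.
  rewrite quad_char0 addr0 (_ : [set s | _] = [set 0]) ?cards1 //.
  by apply/setP => s; rewrite !inE expf_eq0.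
case: (quad_charP x0) => -[]; last first.
  move=> ns ->; rewrite subrr (_ : [set s | _] = set0) ?cards0 //.
  by apply/setP => s; rewrite !inE; apply/negbTE.
move=> [s s0 ->] ->; rewrite (_ : [set _ | _] = [set s; - s]).
  rewrite cards2 (_ : s != - s) //.
  by rewrite -addr_eq0 -mulr2n -mulr_natl mulf_neq0 ?char_two_neq0.
by apply/setP => t; rewrite !inE eqf_sqr.
Qed.

Lemma sum_sqr (f : F -> algC) :
  \sum_(s : F) f (s ^+ 2) = \sum_(x : F) (1 + eta x) * f x.
Proof.
rewrite (partition_big (fun s : F => s ^+ 2) xpredT) //=; apply: eq_bigr => x _.
rewrite -card_sqrt mulr_natl -sumr_const; apply: eq_big => [s|s /eqP -> //].
by rewrite inE.
Qed.

Lemma sum_quad_char : \sum_x eta x = 0.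
Proof.
have := sum_sqr (fun _ => 1); under [RHS]eq_bigr => x _ do rewrite mulr1.
by rewrite big_split /= => /eqP; rewrite -subr_eq0 opprD addrA subrr sub0r oppr_eq0 => /eqP.
Qed.

Lemma quad_char_sqrM (s x : F) : s != 0 -> eta (s ^+ 2 * x) = eta x.
Proof.
move=> s0; have [->|x0] := eqVneq x 0; first by rewrite mulr0.
rewrite /quad_char mulf_eq0 expf_eq0 (negPf s0) (negPf x0) /=.
suff -> : [exists t : F, t ^+ 2 == s ^+ 2 * x] = [exists t : F, t ^+ 2 == x] by [].
apply/existsP/existsP => -[t /eqP e].
  by exists (t / s); rewrite expr_div_n e mulrC mulKf ?expf_neq0.
by exists (s * t); rewrite exprMn e.
Qed.

(* For a nonsquare n, every [eta x + eta (n * x)] is at most 0, while these numbers sum to 0. *)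
Lemma quad_char_nonsqrM (n x : F) : eta n = -1 -> eta (n * x) = - eta x.
Proof.
move=> en; have n0 : n != 0.
  by apply: contra_eq_neq en => ->; rewrite quad_char0 eq_sym oppr_eq0 oner_eq0.
have key y : 0 <= - (eta y + eta (n * y)).
  have [->|y0] := eqVneq y 0; first by rewrite mulr0 quad_char0 addr0 oppr0.
  case: (quad_charP y0) => -[].
    move=> [s s0 ->] _; rewrite mulrC !quad_char_sqrM // -[s ^+ 2]mulr1.
    by rewrite quad_char_sqrM // quad_char1 en subrr oppr0.
  move=> _ ->; case: (quad_charP (mulf_neq0 n0 y0)) => -[_ ->].
    by rewrite addNr oppr0.
  by rewrite -opprD opprK addr_ge0 ?ler01.
have sum0 : \sum_y - (eta y + eta (n * y)) = 0.
  rewrite sumrN big_split /= sum_quad_char add0r.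
  by rewrite -(reindex_inj (mulfI n0) (F := eta) (P := xpredT)) sum_quad_char oppr0.
have /eqP : - (eta x + eta (n * x)) = 0 by apply: (psumr_eq0P (fun y _ => key y) sum0).
by rewrite oppr_eq0 addrC addr_eq0 => /eqP.
Qed.

Lemma quad_charM (x y : F) : eta (x * y) = eta x * eta y.
Proof.
have [->|x0] := eqVneq x 0; first by rewrite mul0r quad_char0 mul0r.
case: (quad_charP x0) => -[].
  by move=> [s s0 ->] ->; rewrite quad_char_sqrM // mul1r.
by move=> _ e; rewrite quad_char_nonsqrM // e mulN1r.
Qed.

Lemma quad_charV (x : F) : eta x^-1 = eta x.
Proof.
have [->|x0] := eqVneq x 0; first by rewrite invr0.
by rewrite -(quad_char_sqrM x^-1 x0) expr2 mulfK.
Qed.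

End QuadChar.

Section Gauss.
Variables (F : finFieldType) (chi : F -> algC) (t0 : F).
Hypothesis ch2 : 2%N \notin [pchar F].
Hypothesis chiD : forall x y, chi (x + y) = chi x * chi y.
Hypothesis chi0 : chi 0 = 1.
Hypothesis chi_norm : forall x, `|chi x| = 1.
Hypothesis chi1 : chi t0 != 1.
Local Notation q := #|F|.
Local Notation eta := (@quad_char F).

Definition gauss_sum (u : F) : algC := \sum_(s : F) chi (u * s ^+ 2).

Lemma gauss_sum_norm u : u != 0 -> `|gauss_sum u| ^+ 2 = q%:R.
Proof.
move=> u0; rewrite normCK /gauss_sum rmorph_sum /= mulr_sumr.
transitivity (\sum_(y : F) \sum_(h : F) chi (u * h ^+ 2) * chi (y * (2%:R * u * h))).
  apply: eq_bigr => y _; rewrite mulr_suml (reindex_inj (addrI y)) /=; apply: eq_bigr => h _.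
  by rewrite (conj_chi chiD chi0 chi_norm) -!chiD; congr chi; ring.
rewrite exchange_big /=.
under eq_bigr => h _ do rewrite -mulr_sumr (sum_chi_mul chiD chi0 chi1).
rewrite (bigD1 0) //= mulr0 eqxx expr0n mulr0 chi0 mul1r big1 ?addr0 // => h h0.
by rewrite !mulf_eq0 (negPf h0) (negPf u0) (negPf (char_two_neq0 ch2)) /= mulr0.
Qed.

Lemma gauss_sumE u : u != 0 -> gauss_sum u = \sum_x eta x * chi (u * x).
Proof.
move=> u0; rewrite /gauss_sum (sum_sqr ch2 (fun x => chi (u * x))).
under eq_bigr => x _ do rewrite mulrDl mul1r.
rewrite big_split /= [X in X + _](_ : _ = 0) ?add0r //.
under eq_bigr => x _ do rewrite mulrC.
by rewrite (sum_chi_mul chiD chi0 chi1) (negPf u0).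
Qed.

Lemma gauss_sum_quad u : u != 0 -> gauss_sum u = eta u * gauss_sum 1.
Proof.
move=> u0; rewrite !gauss_sumE ?oner_neq0 // (reindex_inj (mulfI (invr_neq0 u0))) mulr_sumr /=.
by apply: eq_bigr => x _; rewrite mulVKf // mul1r (quad_charM ch2) quad_charV mulrA.
Qed.

(** The equation is s^2 - (w - 2) s + 1 = 0, of discriminant w (w - 4). *)
Lemma card_add_inv_fiber (w : F) :
  (#|[set s : F | (s != 0) && (s + s^-1 + 2%:R == w)]|)%:R = 1 + eta (w * (w - 4%:R)).
Proof.
rewrite -(card_sqrt ch2); congr (_%:R); have n2 := char_two_neq0 ch2.
pose g (z : F) := (z + (w - 2%:R)) / 2%:R.
have gK : cancel (fun s => 2%:R * s - (w - 2%:R)) g by move=> s; rewrite /g subrK mulrC mulKf.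
have gI : injective g by move=> x y /(mulIf (invr_neq0 n2))/addIr.
rewrite -[RHS](card_imset _ gI); apply: eq_card => s; rewrite inE.
have E : 4%:R * (s * s + 1 + 2%:R * s - w * s)
  = (2%:R * s - (w - 2%:R)) ^+ 2 - w * (w - 4%:R) by ring.
have n4 : (4%:R : F) != 0 by rewrite (natrM _ 2 2) mulf_neq0.
apply/idP/imsetP => [/andP[s0 /eqP e]|[z]].
  exists (2%:R * s - (w - 2%:R)); last by rewrite gK.
  rewrite inE -subr_eq0 -E mulf_eq0 (negPf n4) /= -e; apply/eqP; field; exact: s0.
rewrite inE => /eqP ez ->; have zE : z = 2%:R * g z - (w - 2%:R) by rewrite /g; field.
have : 4%:R * (g z * g z + 1 + 2%:R * g z - w * g z) = 0.
  transitivity ((2%:R * g z - (w - 2%:R)) ^+ 2 - w * (w - 4%:R)); first by ring.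
  by rewrite -zE ez subrr.
move/eqP; rewrite mulf_eq0 (negPf n4) /= => /eqP e.
have gz0 : g z != 0.
  by apply/eqP => gz; move: e; rewrite gz !mulr0 add0r !addr0 subr0 => /eqP; rewrite oner_eq0.
rewrite gz0 /= -subr_eq0 -(inj_eq (mulIf gz0)) mul0r -e; apply/eqP; field; exact: gz0.
Qed.

(* For s != -1, (s + 1)^2 / s = w := s + 1/s + 2 shows that eta s = eta w. *)
Lemma salie_unit e : e != 0 ->
  \sum_(s : F | s != 0) eta s * chi (e * (s + s^-1))
  = (chi (2%:R * e) + chi (- (2%:R * e))) * gauss_sum e.
Proof.
move=> e0; have n2 := char_two_neq0 ch2.
have n4 : (4%:R : F) != 0 by rewrite (natrM _ 2 2) mulf_neq0.
pose w s : F := s + s^-1 + 2%:R.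
have wE s : s != 0 -> w s = (s + 1) ^+ 2 * s^-1 by move=> s0; rewrite /w; field.
have S1 : \sum_(s : F | s != 0) eta s * chi (e * (s + s^-1))
   = \sum_(s : F | s != 0) eta (w s) * chi (e * (w s - 2%:R)) + eta (-1) * chi (- (2%:R * e)).
  have m0 : (-1 : F) != 0 by rewrite oppr_eq0 oner_neq0.
  rewrite (bigD1 (-1)) //= [X in _ = X + _](bigD1 (-1)) //=.
  rewrite (wE _ m0) addNr expr0n mul0r quad_char0 mul0r add0r addrC; congr (_ + _).
    apply: eq_bigr => s /andP[s0 s1]; rewrite wE // quad_char_sqrM ?quad_charV.
      by rewrite -wE // /w addrK.
    by rewrite addr_eq0.
  by rewrite invrN invr1; congr (_ * chi _); ring.
have S2 : \sum_(s : F | s != 0) eta (w s) * chi (e * (w s - 2%:R))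
   = \sum_x (1 + eta (x * (x - 4%:R))) * (eta x * chi (e * (x - 2%:R))).
  rewrite (partition_big w xpredT) //=; apply: eq_bigr => x _.
  rewrite -card_add_inv_fiber mulr_natl -sumr_const; apply: eq_big => [s|s /andP[_ /eqP -> //]].
  by rewrite inE.
have S3 : \sum_x eta x * chi (e * (x - 2%:R)) = chi (- (2%:R * e)) * gauss_sum e.
  rewrite gauss_sumE // mulr_sumr; apply: eq_bigr => x _.
  by rewrite mulrCA -chiD; congr (_ * chi _); ring.
(* For x != 0 the two characters combine to eta (x - 4), a shifted Gauss sum. Its term x = 0, where
   eta (-4) = eta (-1), is missing on the left; it will cancel the term s = -1 isolated in [S1]. *)
have S4 : \sum_x eta (x * (x - 4%:R)) * (eta x * chi (e * (x - 2%:R)))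
   = chi (2%:R * e) * gauss_sum e - eta (-1) * chi (- (2%:R * e)).
  have -> : chi (2%:R * e) * gauss_sum e = \sum_x eta (x - 4%:R) * chi (e * (x - 2%:R)).
    rewrite gauss_sumE // mulr_sumr (reindex_inj (addIr (- 4%:R))); apply: eq_bigr => x _ /=.
    by rewrite mulrCA -chiD; congr (_ * chi _); ring.
  rewrite (bigD1 0) //= !(mul0r, quad_char0, mulr0) add0r [in RHS](bigD1 0) //= !sub0r addrAC.
  have -> : eta (- 4%:R) = eta (-1).
    by rewrite -(@quad_char_sqrM F 2%:R (-1) n2) mulrN1 -natrX.
  rewrite mulrN [e * _]mulrC subrr add0r; apply: eq_bigr => x x0.
  rewrite (quad_charM ch2) -[RHS]mul1r -(quad_char_sqr x0); ring.
rewrite S1 S2; under eq_bigr => x _ do rewrite mulrDl mul1r.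
by rewrite big_split /= S3 S4; ring.
Qed.

(** If u v is not a square, the substitution s -> v / (u s) exchanges the two terms of the argument
    and changes the sign of eta, so the sum is 0. If u v = e^2, scaling s by e / u reduces to
    [salie_unit]. *)
Lemma salie_bound u v : u != 0 -> v != 0 ->
  `|\sum_(s : F | s != 0) eta s * chi (s * u + v / s)| ^+ 2 <= 4%:R * q%:R.
Proof.
move=> u0 v0; set S := \sum_(s | _) _.
have c0 : u * v != 0 by rewrite mulf_neq0.
case: (quad_charP c0) => -[]; last first.
  move=> _ ec; suff -> : S = 0 by rewrite normr0 expr0n mulr_ge0 ?ler0n.
  have : S = - S.
    rewrite {1}/S (reindex_onto (fun s => (v / u) / s) (fun s => (v / u) / s)) /=; last first.
      by move=> s s0; field; rewrite s0 u0 v0.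
    rewrite -sumrN; apply: eq_big => s.
      have [->|s0] := eqVneq s 0; first by rewrite invr0 mulr0 eqxx.
      rewrite !mulf_neq0 ?invr_neq0 //=; apply/eqP; field; by rewrite s0 u0 v0.
    case/andP=> s1 _; have s0 : s != 0 by apply: contraNneq s1 => ->; rewrite invr0 mulr0.
    rewrite -mulNr; congr (_ * chi _); last by field; rewrite s0 u0 v0.
    by rewrite !(quad_charM ch2) !quad_charV -(quad_charM ch2) [v * u]mulrC ec mulN1r.
  by move/eqP; rewrite -addr_eq0 -mulr2n mulrn_eq0 /= => /eqP.
move=> [e e0 ee] _.
have -> : S = eta (e / u) * \sum_(s : F | s != 0) eta s * chi (e * (s + s^-1)).
  have eu0 : e / u != 0 by rewrite mulf_neq0 ?invr_neq0.
  rewrite /S (reindex_inj (mulfI eu0)) mulr_sumr /=; apply: eq_big => s.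
    by rewrite mulf_eq0 (negPf eu0).
  move=> _; have vE : v = e ^+ 2 / u by rewrite -ee mulrC mulKf.
  rewrite (quad_charM ch2 (e / u) s) -mulrA; congr (_ * (_ * chi _)).
  have [->|s0] := eqVneq s 0; first by rewrite !(mulr0, invr0, mul0r, addr0).
  by rewrite vE; field; rewrite s0 u0 e0.
rewrite salie_unit // !normrM gauss_sum_quad // normrM !exprMn gauss_sum_norm ?oner_neq0 //.
have nq x : x != 0 -> `|eta x| ^+ 2 = 1 by move=> x0; rewrite -normrX quad_char_sqr ?normr1.
rewrite !nq ?mulf_neq0 ?invr_neq0 // !mul1r ler_wpM2r ?ler0n //.
have -> : 4%:R = 2%:R ^+ 2 :> algC by rewrite -natrX.
rewrite ler_pXn2r ?nnegrE ?normr_ge0 ?ler0n //.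
by apply: le_trans (ler_normD _ _) _; rewrite !chi_norm -[2%:R]natr1.
Qed.

(** In the application r is the norm of a frequency and may vanish: the sum is then a Gauss sum (d
    odd) or -1 (d even). Otherwise it is a Salie sum or a Kloosterman sum. *)
Lemma twisted_kloosterman_bound d r l : l != 0 ->
  `|\sum_(u : F | u != 0) eta u ^+ d * chi (u * r + l / u)| ^+ 2 <= 4%:R * q%:R.
Proof.
move=> l0; have q1 : (1 < q)%N := finNzRing_gt1 F.
have q4 : (1 : algC) <= 4%:R * q%:R by rewrite -natrM ler1n muln_gt0 (ltnW q1).
pose e : bool := odd d.
have etaX u : u != 0 -> eta u ^+ d = eta u ^+ e.
  move=> u0; rewrite -[d in LHS]odd_double_half exprD -muln2 mulnC exprM.
  by rewrite quad_char_sqr // expr1n mulr1.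
rewrite (eq_bigr (fun u => eta u ^+ e * chi (u * r + l / u))); last by move=> u u0; rewrite etaX.
have [r0|r0] := eqVneq r 0.
  rewrite r0 (reindex_inj invr_inj) /=.
  under eq_bigr => u u0 do rewrite mulr0 add0r invrK quad_charV.
  case: (e); rewrite ?expr1; last first.
    have := sum_chi_mul chiD chi0 chi1 l; rewrite (negPf l0) (bigD1 0) //= mul0r chi0 => /eqP.
    rewrite addrC addr_eq0 => /eqP e1.
    have -> : \sum_(u : F | u^-1 != 0) eta u ^+ 0 * chi (l * u) = -1.
      by rewrite -e1; apply: eq_big => [u|u _]; rewrite ?invr_eq0 // expr0 mul1r mulrC.
    by rewrite normrN1 expr1n.
  have -> : \sum_(u : F | u^-1 != 0) eta u ^+ true * chi (l * u) = gauss_sum l.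
    rewrite gauss_sumE // [RHS](bigD1 0) //= quad_char0 mul0r add0r.
    by apply: eq_big => [u|u _]; rewrite ?invr_eq0.
  by rewrite gauss_sum_norm // ler_peMl ?ler0n // ler1n.
case: (e); first exact: salie_bound.
have -> : \sum_(u : F | u != 0) eta u ^+ false * chi (u * r + l / u) = kloosterman chi (l / r) r.
  apply: eq_bigr => u u0; rewrite expr0 mul1r; congr chi; field; by rewrite u0 r0.
have KR := kloosterman_real chiD chi0 chi_norm (l / r) r.
rewrite real_normK //; apply: (kloosterman_bound ch2 chiD chi0 chi_norm chi1) => //.
by rewrite mulf_neq0 ?invr_neq0.
Qed.

End Gauss.

(** * Pairs of points at a given distance *)

Lemma cauchy_schwarz_sum (I : finType) (x y : I -> algC) :
  `|\sum_i x i * y i| ^+ 2 <= (\sum_i `|x i| ^+ 2) * (\sum_i `|y i| ^+ 2).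
Proof.
pose a i := `|x i|; pose b i := `|y i|.
apply: le_trans (_ : (\sum_i a i * b i) ^+ 2 <= _).
  rewrite ler_pXn2r ?nnegrE ?sumr_ge0 ?normr_ge0 // => [|i _]; last by rewrite mulr_ge0 ?normr_ge0.
  by apply: le_trans (ler_norm_sum _ _ _) _; apply: ler_sum => i _; rewrite normrM.
have : 0 <= \sum_i \sum_j (a i * b j - a j * b i) ^+ 2.
  apply: sumr_ge0 => i _; apply: sumr_ge0 => j _; apply: real_exprn_even_ge0 => //.
  by rewrite rpredB ?rpredM ?normr_real.
have -> : \sum_i \sum_j (a i * b j - a j * b i) ^+ 2
  = ((\sum_i a i ^+ 2) * (\sum_i b i ^+ 2) - (\sum_i a i * b i) ^+ 2) *+ 2.
  transitivity (\sum_i \sum_j (a i ^+ 2 * b j ^+ 2 + b i ^+ 2 * a j ^+ 2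
                               - (a i * b i) * (a j * b j) *+ 2)).
    by apply: eq_bigr => i _; apply: eq_bigr => j _; ring.
  under eq_bigr => i _ do rewrite sumrB big_split /= -!mulr_sumr sumrMnl -mulr_sumr.
  rewrite sumrB big_split /= -!mulr_suml sumrMnl -mulr_suml; ring.
by rewrite pmulrn_lge0 // subr_ge0.
Qed.

Lemma sum_prod_row (F : finFieldType) (d : nat) (g : 'I_d -> F -> algC) :
  \sum_(xi : 'rV[F]_d) \prod_(j < d) g j (xi 0 j) = \prod_(j < d) \sum_(t : F) g j t.
Proof.
rewrite bigA_distr_bigA /= (reindex (fun f : {ffun 'I_d -> F} => \row_j f j)) /=.
  by apply: eq_bigr => f _; apply: eq_bigr => j _; rewrite mxE.
exists (fun v : 'rV_d => [ffun j => v 0 j]) => [f _|v _].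
  by apply/ffunP => j; rewrite ffunE mxE.
by apply/rowP => j; rewrite mxE ffunE.
Qed.

Lemma dotvB (F : fieldType) d (x y z : 'rV[F]_d) : dotv (x - y) z = dotv x z - dotv y z.
Proof. by rewrite /dotv -sumrB; apply: eq_bigr => j _; rewrite !mxE mulrBl. Qed.

Section Mixing.
Variables (F : finFieldType) (chi : F -> algC) (t0 : F).
Hypothesis ch2 : 2%N \notin [pchar F].
Hypothesis chiD : forall x y, chi (x + y) = chi x * chi y.
Hypothesis chi0 : chi 0 = 1.
Hypothesis chi_norm : forall x, `|chi x| = 1.
Hypothesis chi1 : chi t0 != 1.
Variable d : nat.
Local Notation q := #|F|.
Local Notation eta := (@quad_char F).
Local Notation G := (gauss_sum chi).
Implicit Types (x y z xi : 'rV[F]_d) (A B : {set 'rV[F]_d}).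

Lemma chi_sum (I : finType) (f : I -> F) : chi (\sum_i f i) = \prod_i chi (f i).
Proof. exact: (big_morph chi chiD chi0). Qed.

Lemma sum_chi_dotv z : \sum_xi chi (dotv z xi) = if z == 0 then (q ^ d)%:R else 0.
Proof.
under eq_bigr => xi _ do rewrite /dotv chi_sum.
rewrite (sum_prod_row (fun j t => chi (z 0 j * t))).
have sE j : \sum_t chi (z 0 j * t) = if z 0 j == 0 then q%:R else 0.
  by under eq_bigr => t _ do rewrite mulrC; rewrite (sum_chi_mul chiD chi0 chi1).
under eq_bigr => j _ do rewrite sE.
case: eqP => [->|z0].
  by under eq_bigr => j _ do rewrite mxE eqxx; rewrite prodr_const card_ord natrX.
have [j zj] : exists j, z 0 j != 0.
  apply/existsP; apply: contraT; rewrite negb_exists => /forallP H; case: z0.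
  by apply/rowP => j; rewrite mxE; apply/eqP; rewrite -[_ == _]negbK H.
by rewrite (bigD1 j) //= (negPf zj) mul0r.
Qed.

Lemma gauss_fourier u z : u != 0 ->
  \sum_xi chi (dotv z xi + u * sqnorm xi) = chi (- (sqnorm z / (4%:R * u))) * G u ^+ d.
Proof.
move=> u0; have n2 := char_two_neq0 ch2.
transitivity (\sum_(xi : 'rV[F]_d) \prod_(j < d) chi (z 0 j * xi 0 j + u * xi 0 j ^+ 2)).
  apply: eq_bigr => xi _; rewrite -chi_sum big_split /= -mulr_sumr; congr (chi (_ + _ * _)).
rewrite (sum_prod_row (fun j t => chi (z 0 j * t + u * t ^+ 2))).
have cE j : \sum_t chi (z 0 j * t + u * t ^+ 2) = chi (- (z 0 j * z 0 j / (4%:R * u))) * G u.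
  rewrite (reindex_inj (addIr (- (z 0 j / (2%:R * u))))) mulr_sumr; apply: eq_bigr => t _ /=.
  rewrite -chiD; congr chi; field.
  by rewrite u0 n2 (natrM _ 2 2) mulf_neq0.
under eq_bigr => j _ do rewrite cE.
rewrite big_split /= prodr_const card_ord -chi_sum; congr (chi _ * _).
by rewrite sumrN -mulr_suml.
Qed.

Definition set_fourier A xi : algC := \sum_(x in A) chi (dotv x xi).

Lemma parseval A : \sum_xi `|set_fourier A xi| ^+ 2 = (q ^ d * #|A|)%:R.
Proof.
transitivity (\sum_xi \sum_(x in A) \sum_(y in A) chi (dotv (x - y) xi)).
  apply: eq_bigr => xi _; rewrite normCK rmorph_sum mulr_suml; apply: eq_bigr => x _.
  rewrite mulr_sumr; apply: eq_bigr => y _ /=.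
  by rewrite (conj_chi chiD chi0 chi_norm) -chiD dotvB.
rewrite exchange_big /= mulnC natrM mulr_natl -sumr_const; apply: eq_bigr => x xA.
rewrite exchange_big /=; under eq_bigr => y _ do rewrite sum_chi_dotv.
rewrite (bigD1 x) //= subrr eqxx big1 ?addr0 // => y /andP[_ yx].
by rewrite subr_eq0 eq_sym (negPf yx).
Qed.

(** Orthogonality in s detects the distance [lam]; the frequency s = 0 gives the expected count
    |A||B|, moved to the left. *)
Lemma sphere_deviation A B lam :
  (q * #|[set p | [&& p.1 \in A, p.2 \in B & sqnorm (p.1 - p.2) == lam]]|)%:R - (#|A| * #|B|)%:R
  = \sum_(x in A) \sum_(y in B) \sum_(s : F | s != 0) chi (s * (sqnorm (x - y) - lam)).
Proof.
have inner (v : F) : \sum_(s : F | s != 0) chi (s * v) = q%:R * (v == 0)%:R - 1.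
  have := sum_chi_mul chiD chi0 chi1 v; rewrite (bigD1 0) //= mul0r chi0 => e.
  rewrite -[LHS](addKr 1) e addrC; congr (_ - _).
  by case: (v == 0); rewrite ?mulr1 ?mulr0.
under eq_bigr => x _ do under eq_bigr => y _ do rewrite inner.
under eq_bigr => x _ do rewrite sumrB sumr_const -mulr_sumr.
rewrite sumrB sumr_const -mulr_sumr natrM -mulrnA mulnC; congr (_ * _ - _).
rewrite -sum1_card natr_sum pair_big_dep big_mkcond [RHS]big_mkcond /=.
apply: eq_bigr => -[x y] _; rewrite inE /= subr_eq0.
by case: (x \in A); case: (y \in B); case: eqP.
Qed.

(* The two exponential sums over the sphere parameter [s] are matched by [s = - 1 / (4 u)]. *)
Lemma sphere_deviation_fourier A B lam :
  \sum_(x in A) \sum_(y in B) \sum_(s : F | s != 0) chi (s * (sqnorm (x - y) - lam))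
  = \sum_xi (G 1 ^- d * (\sum_(u : F | u != 0) eta u ^+ d * chi (u * sqnorm xi + (lam / 4%:R) / u))
      * set_fourier A xi) * (set_fourier B xi)^*.
Proof.
have n2 := char_two_neq0 ch2.
have n4 : (4%:R : F) != 0 by rewrite (natrM _ 2 2) mulf_neq0.
have q0 : (q%:R : algC) != 0 by rewrite pnatr_eq0 -lt0n ltnW ?finNzRing_gt1.
have G0 u : u != 0 -> G u != 0.
  move=> u0; rewrite -normr_eq0 -sqrf_eq0 (gauss_sum_norm ch2 chiD chi0 chi_norm chi1) //.
(* The d-th power of the Gauss sum is the source of the twist eta^d, hence of the dichotomy on the
   parity of d. *)
have GV u : u != 0 -> G u ^- d = eta u ^+ d * G 1 ^- d.
  move=> u0; rewrite (gauss_sum_quad ch2 chiD chi0 chi1 u0) exprMn invfM; congr (_ * _).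
  rewrite -exprVn; congr (_ ^+ _); case: (quad_charP u0) => -[_ ->]; by rewrite ?invrN invr1.
have main x y : \sum_(s : F | s != 0) chi (s * (sqnorm (x - y) - lam))
  = \sum_(u : F | u != 0) eta u ^+ d * G 1 ^- d * chi ((lam / 4%:R) / u)
      * \sum_xi chi (dotv (x - y) xi + u * sqnorm xi).
  pose f (u : F) := - (4%:R * u)^-1.
  have fI : injective f by move=> u v /oppr_inj/invr_inj/(mulfI n4).
  rewrite (reindex_inj fI) /=; apply: eq_big => [u|u].
    by rewrite oppr_eq0 invr_eq0 mulf_eq0 (negPf n4).
  rewrite oppr_eq0 invr_eq0 mulf_eq0 (negPf n4) /= => u0.
  rewrite gauss_fourier // -GV // [X in _ = _ * X]mulrC mulrACA mulVf ?expf_neq0 ?G0 // mul1r -chiD.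
  congr chi; rewrite /f; field; by rewrite u0 n4.
under eq_bigr => x _ do under eq_bigr => y _ do rewrite main.
under eq_bigr => x _ do rewrite exchange_big /=.
rewrite exchange_big /=.
transitivity (\sum_(u : F | u != 0) \sum_xi
  eta u ^+ d * G 1 ^- d * chi ((lam / 4%:R) / u) * chi (u * sqnorm xi)
    * (set_fourier A xi * (set_fourier B xi)^*)).
  apply: eq_bigr => u u0.
  under eq_bigr => x _ do rewrite -mulr_sumr.
  rewrite -[LHS]mulr_sumr.
  under eq_bigr => x _ do rewrite exchange_big /=.
  rewrite exchange_big mulr_sumr; apply: eq_bigr => xi _ /=.
  rewrite -!mulrA; congr (_ * (_ * (_ * _))).
  rewrite rmorph_sum /= mulr_suml mulr_sumr; apply: eq_bigr => x _.
  rewrite !mulr_sumr; apply: eq_bigr => y _.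
  by rewrite (conj_chi chiD chi0 chi_norm) dotvB -!chiD; congr chi; ring.
rewrite exchange_big /=; apply: eq_bigr => xi _.
move: (set_fourier A xi) (_^*) => fa fb.
rewrite mulr_sumr !mulr_suml; apply: eq_bigr => u _; rewrite chiD; ring.
Qed.

(** Cauchy-Schwarz over the frequencies: the kernel has squared modulus at most q^(-d) * 4 q, and
    Parseval contributes q^d |A| and q^d |B|. *)
Lemma sphere_mixing A B lam : lam != 0 ->
  `|(q * #|[set p | [&& p.1 \in A, p.2 \in B & sqnorm (p.1 - p.2) == lam]]|)%:R
    - (#|A| * #|B|)%:R : algC| ^+ 2 <= (4 * q ^ d.+1 * (#|A| * #|B|))%:R.
Proof.
move=> l0; rewrite sphere_deviation sphere_deviation_fourier.
apply: le_trans (cauchy_schwarz_sum _ _) _.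
have n2 := char_two_neq0 ch2.
have n4 : (4%:R : F) != 0 by rewrite (natrM _ 2 2) mulf_neq0.
have q0 : 0 < (q%:R : algC) by rewrite ltr0n ltnW ?finNzRing_gt1.
under [X in _ * X]eq_bigr => xi _ do rewrite norm_conjC.
rewrite parseval.
have GE : `|G 1 ^- d| ^+ 2 = q%:R ^- d.
  rewrite normfV normrX exprVn -exprM mulnC exprM.
  by rewrite (gauss_sum_norm ch2 chiD chi0 chi_norm chi1) ?oner_neq0.
have le : \sum_xi `|G 1 ^- d
      * (\sum_(u : F | u != 0) eta u ^+ d * chi (u * sqnorm xi + (lam / 4%:R) / u))
      * set_fourier A xi| ^+ 2 <= q%:R ^- d * (4%:R * q%:R) * (q ^ d * #|A|)%:R.
  rewrite -parseval mulr_sumr; apply: ler_sum => xi _.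
  rewrite !normrM !exprMn GE ler_wpM2r ?exprn_ge0 ?normr_ge0 //.
  rewrite ler_wpM2l ?invr_ge0 ?exprn_ge0 ?ler0n //.
  apply: (twisted_kloosterman_bound ch2 chiD chi0 chi_norm chi1).
  by rewrite mulf_neq0 ?invr_neq0.
apply: le_trans (ler_wpM2r (ler0n _ _) le) _.
rewrite le_eqVlt; apply/orP; left; apply/eqP.
rewrite !natrM !natrX exprS; field.
by rewrite expf_neq0 // gt_eqF.
Qed.

End Mixing.

Lemma sqnormBC (F : fieldType) d (x y : 'rV[F]_d) : sqnorm (x - y) = sqnorm (y - x).
Proof. by apply: eq_bigr => j _; rewrite !mxE; ring. Qed.

(** Summing the deficits gives a deviation of at least |A||B| / (2 n) in [sphere_mixing], so
    (|A||B|)^2 <= 4 n^2 * 4 q^(d+1) |A||B|. *)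
Lemma few_bad_points (F : finFieldType) (d n : nat) (A B : {set 'rV[F]_d}) (lam : F) :
  2%N \notin [pchar F] -> lam != 0 -> (0 < n)%N ->
  (forall x, x \in A ->
     2 * n * #|F| * #|[set y in B | (sqnorm (x - y) == lam)%R]| <= (2 * n - 1) * #|B|)%N ->
  (#|A| * #|B| <= 16 * n ^ 2 * #|F| ^ d.+1)%N.
Proof.
move=> ch2 l0 n0 bad.
have [chi [t0 [chiD chi0 chi_norm chi1]]] := exists_additive_character F.
have := sphere_mixing ch2 chiD chi0 chi_norm chi1 A B l0.
set e := #|_|; set N := (#|A| * #|B|)%N; set q := #|F|.
have eE : (2 * n * q * e <= (2 * n - 1) * N)%N.
  have -> : e = (\sum_(x in A) #|[set y in B | sqnorm (x - y) == lam]|)%N.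
    rewrite /e -sum1_card; under [RHS]eq_bigr => x _ do rewrite -sum1_card.
    by rewrite pair_big_dep /=; apply: eq_bigl => -[x y]; rewrite !inE.
  rewrite big_distrr /= mulnCA -sum_nat_const.
  by apply: leq_sum => x /bad.
have leN : (q * e <= N)%N by nia.
rewrite distrC -natrB // ger0_norm ?ler0n // -natrX ler_nat => mix.
have [->//|N0] := posnP N.
rewrite -(leq_pmul2l N0); nia.
Qed.

(** * Greedy embedding *)

Section Embedding.
Variables (F : finFieldType) (d n t : nat) (A : {set 'rV[F]_d}).
Hypothesis ch2 : 2%N \notin [pchar F].
Hypothesis d0 : (1 <= d)%N.
Hypothesis cardA : (144 * n ^ 4 * #|F| ^ (d - 1 + 2 * t) <= #|A| ^ 2)%N.
Variables (E : rel 'I_n) (lam : 'I_n -> 'I_n -> F).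
Hypothesis DG : distance_graph E lam.
Hypothesis degE : max_degree_le E t.
Local Notation q := #|F|.
Implicit Types (phi : 'I_n -> 'rV[F]_d) (i j v w : 'I_n).

Definition placed_nbrs m w : {set 'I_n} := [set i : 'I_n | (i < m)%N && E i w].

(** Points already used are not removed, so that the size only depends on distances;
    [good_point_exists] avoids them when a vertex is placed. *)
Definition candidates phi m w : {set 'rV[F]_d} :=
  [set y in A | [forall i, (i \in placed_nbrs m w) ==> (sqnorm (phi i - y) == lam i w)]].

(** The vertices are placed in the order of their indices, and the values of [phi] from m on are
    irrelevant. The last clause is |C_w| >= |A| (1 - r/(2n)) / q^r without denominators, r being the
    number of placed neighbours. *)
Definition partial_embedding m phi : Prop :=
  [/\ forall i j, (i < m)%N -> (j < m)%N -> phi i = phi j -> i = j,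
      forall i, (i < m)%N -> phi i \in A,
      forall i j, (i < m)%N -> (j < m)%N -> E i j -> sqnorm (phi i - phi j) = lam i j &
      forall w, (m <= w)%N -> (#|A| * (2 * n - #|placed_nbrs m w|)
                  <= 2 * n * q ^ #|placed_nbrs m w| * #|candidates phi m w|)%N].

Let q0 : (0 < q)%N. Proof. exact: ltnW (finNzRing_gt1 F). Qed.

Lemma placed_nbrs_deg m w : (#|placed_nbrs m w| <= t)%N.
Proof.
have [_ sym _ _] := DG.
apply: leq_trans (degE w); apply/subset_leq_card/subsetP => i; rewrite !inE sym.
by case/andP.
Qed.

Lemma placed_nbrs_deg_lt m v w : (m <= v)%N -> E v w -> (#|placed_nbrs m w| < t)%N.
Proof.
have [_ sym _ _] := DG => mv vw.
apply: leq_trans (degE w); apply/proper_card/properP; split.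
  by apply/subsetP => i; rewrite !inE sym => /andP[].
by exists v; rewrite !inE ?(sym w) // ltnNge mv.
Qed.

(* Bernoulli: (1 - 1/(2n))^r >= 1 - r/(2n) >= 1/2 underlies the weight (2n - r) / (2n). *)
Lemma candidates_card m phi w : (m <= w)%N -> partial_embedding m phi ->
  (#|A| <= 2 * q ^ #|placed_nbrs m w| * #|candidates phi m w|)%N.
Proof.
move=> mw [_ _ _ /(_ w mw)].
have n0 : (0 < n)%N by apply: leq_ltn_trans (ltn_ord w).
have rn : (#|placed_nbrs m w| <= n)%N by rewrite -[X in (_ <= X)%N]card_ord max_card.
set r := #|placed_nbrs m w| in rn *; set c := #|candidates phi m w| => le.
rewrite -(leq_pmul2l n0).
apply: leq_trans (_ : #|A| * (2 * n - r) <= _)%N.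
  by rewrite mulnC leq_mul2l; apply/orP; right; lia.
by apply: leq_trans le _; lia.
Qed.

(** As d >= 1, |A| is at least 12 n^2 q^t, and at most t neighbours of w are placed. *)
Lemma candidates_sqr m phi w : (m <= w)%N -> partial_embedding m phi ->
  (6 * n ^ 2 <= #|candidates phi m w|)%N.
Proof.
move=> mw /(candidates_card mw); have := placed_nbrs_deg m w.
set r := #|placed_nbrs m w|; set c := #|candidates phi m w| => rt le.
have : (144 * n ^ 4 * q ^ (2 * r) <= (2 * q ^ r * c) ^ 2)%N.
  apply: leq_trans (_ : #|A| ^ 2 <= _)%N; last by rewrite leq_exp2r.
  apply: leq_trans cardA; rewrite leq_mul2l leq_pexp2l ?orbT //; lia.
have -> : (144 * n ^ 4 * q ^ (2 * r) = 4 * q ^ (2 * r) * (6 * n ^ 2) ^ 2)%N.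
  by rewrite expnMn -expnM; lia.
have -> : ((2 * q ^ r * c) ^ 2 = 4 * q ^ (2 * r) * c ^ 2)%N.
  by rewrite !expnMn -expnM [(r * 2)%N]mulnC.
by rewrite leq_pmul2l ?leq_exp2r // muln_gt0 expn_gt0 q0.
Qed.

(** Each of v and w is an unplaced neighbour of the other, so each has at most t - 1 placed ones.
    This saves a factor q^2 and turns the q^(d-1) of the hypothesis into the q^(d+1) of
    [few_bad_points]. *)
Lemma candidates_mul m phi v w : (m <= v)%N -> (m <= w)%N -> E v w -> partial_embedding m phi ->
  (36 * n ^ 4 * q ^ d.+1 <= #|candidates phi m v| * #|candidates phi m w|)%N.
Proof.
have [_ sym _ _] := DG => mv mw vw emb.
have := candidates_card mv emb; have := candidates_card mw emb.
have := placed_nbrs_deg_lt mv vw; rewrite sym in vw; have := placed_nbrs_deg_lt mw vw.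
set s := #|placed_nbrs m w|; set r := #|placed_nbrs m v|.
set cw := #|candidates phi m w|; set cv := #|candidates phi m v|.
move=> st rt lew lev.
have := leq_mul lev lew; rewrite mulnn => le.
have := leq_trans cardA le.
have -> : (2 * q ^ r * cv * (2 * q ^ s * cw) = 4 * (cv * cw) * q ^ (s + r))%N by rewrite expnD; lia.
have -> : (144 * n ^ 4 * q ^ (d - 1 + 2 * t) =
   4 * (36 * n ^ 4 * q ^ d.+1) * q ^ (2 * t - 2))%N.
  have -> : (d - 1 + 2 * t = d.+1 + (2 * t - 2))%N by lia.
  by rewrite expnD; lia.
move=> le2; rewrite -(leq_pmul2l (isT : 0 < 4)%N).
have : (0 < q ^ (2 * t - 2))%N by rewrite expn_gt0 q0.
move/leq_pmul2r <-; apply: leq_trans le2 _.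
by rewrite leq_mul2l leq_pexp2l ?orbT //; lia.
Qed.

Definition bad_points phi m v w : {set 'rV[F]_d} :=
  [set x in candidates phi m v |
    (2 * n * q * #|[set y in candidates phi m w | (sqnorm (x - y) == lam v w)%R]|
      <= (2 * n - 1) * #|candidates phi m w|)%N].

Lemma bad_points_card m phi v w : (m <= v)%N -> (m <= w)%N -> E v w -> partial_embedding m phi ->
  (9 * n ^ 2 * #|bad_points phi m v w| <= 4 * #|candidates phi m v|)%N.
Proof.
have [_ _ _ lam0] := DG => mv mw vw emb.
have n0 : (0 < n)%N by apply: leq_ltn_trans (ltn_ord w).
have := candidates_mul mv mw vw emb; have := candidates_sqr mw emb.
have := few_bad_points (A := bad_points phi m v w) (B := candidates phi m w) ch2 (lam0 _ _ vw) n0.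
set cw := #|candidates _ _ w|; set cv := #|candidates _ _ v|; set b := #|bad_points _ _ _ _|.
move=> few cw6 cvw.
have {few} : (b * cw <= 16 * n ^ 2 * q ^ d.+1)%N by apply: few => x; rewrite inE => /andP[].
have cw0 : (0 < cw)%N by apply: leq_trans cw6; rewrite muln_gt0 expn_gt0 n0.
move=> few; rewrite -(leq_pmul2r cw0) -mulnA -[X in (_ <= X)%N]mulnA.
apply: leq_trans (_ : 9 * n ^ 2 * (16 * n ^ 2 * q ^ d.+1) <= _)%N.
  by rewrite leq_mul2l few orbT.
apply: leq_trans (_ : 4 * (36 * n ^ 4 * q ^ d.+1) <= _)%N; last by rewrite leq_mul2l cvw orbT.
by rewrite (_ : n ^ 4 = n ^ 2 * n ^ 2)%N; [lia | rewrite -expnD].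
Qed.

(** The at most n neighbours of v exclude at most 4/9 of its candidates, each at most 4/(9 n^2) of
    them; the points already used are at most n <= n^2, so at most 1/6 of them. *)
Lemma good_point_exists m phi v : m = v :> nat -> partial_embedding m phi ->
  exists x, [/\ x \in candidates phi m v, forall i, (i < m)%N -> phi i != x &
    forall w, (m < w)%N -> E v w -> x \notin bad_points phi m v w].
Proof.
move=> mv emb; have lemv : (m <= v)%N by rewrite mv.
have n0 : (0 < n)%N by apply: leq_ltn_trans (ltn_ord v).
pose X := \bigcup_(w : 'I_n | (m < w)%N && E v w) bad_points phi m v w.
pose U := phi @: [set i : 'I_n | (i < m)%N].
have cX : (9 * #|X| <= 4 * #|candidates phi m v|)%N.
  have : (#|X| <= \sum_(w : 'I_n | (m < w)%N && E v w) #|bad_points phi m v w|)%N.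
    rewrite /X; elim/big_rec2: _ => [|w c Y _ le]; first by rewrite cards0.
    by apply: leq_trans (leq_card_setU _ _) _; rewrite leq_add2l.
  move=> leX; rewrite -(leq_pmul2l (_ : 0 < n ^ 2)%N) ?expn_gt0 ?n0 //.
  apply: leq_trans (_ : \sum_(w : 'I_n) 4 * #|candidates phi m v| <= _)%N; last first.
    by rewrite sum_nat_const card_ord leq_mul2r -mulnn leq_pmulr ?orbT.
  rewrite mulnA [(n ^ 2 * 9)%N]mulnC.
  apply: leq_trans (leq_mul (leqnn _) leX) _; rewrite big_distrr /= big_mkcond.
  apply: leq_sum => w _; case: ifP => // /andP[mw vw].
  by apply: bad_points_card => //; apply: ltnW.
have cU : (#|U| <= n)%N.
  by apply: leq_trans (leq_imset_card _ _) _; rewrite -[X in (_ <= X)%N]card_ord max_card.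
have c6 := candidates_sqr lemv emb.
have : (#|X :|: U| < #|candidates phi m v|)%N.
  apply: leq_ltn_trans (leq_card_setU _ _) _.
  have : (n <= n ^ 2)%N by rewrite -mulnn leq_pmulr.
  move: c6 cX cU n0; set c := #|candidates _ _ _|; set a := #|X|; set b := #|U|; lia.
rewrite ltnNge => /negP H.
have [x xc xn] : exists2 x, x \in candidates phi m v & x \notin X :|: U.
  by apply/subsetPn; apply/negP => /subset_leq_card.
move: xn; rewrite inE negb_or => /andP[xX xU]; exists x; split=> // [i im|w mw vw].
  by apply: contraNneq xU => <-; apply: imset_f; rewrite inE.
by apply: contra xX => xb; apply/bigcupP; exists w => //; rewrite mw.
Qed.

Lemma partial_embedding_step m phi : (m < n)%N -> partial_embedding m phi ->
  exists phi', partial_embedding m.+1 phi'.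
Proof.
move=> mn emb; have [irr sym lsym _] := DG.
pose v := Ordinal mn; have mv : m = v :> nat by [].
have [x [xc xU xB]] := good_point_exists mv emb.
have [inj inA dist cand] := emb.
pose phi' i := if i == v then x else phi i.
have phi'v : phi' v = x by rewrite /phi' eqxx.
have phi'E i : (i < m)%N -> phi' i = phi i.
  by move=> im; rewrite /phi'; case: eqP => // iv; rewrite iv ltnn in im.
have ltmS i : (i < m.+1)%N -> i = v \/ (i < m)%N.
  by rewrite ltnS leq_eqVlt => /orP[/eqP e|]; [left; apply: val_inj | right].
have [xA xd] : x \in A /\ forall i, (i < m)%N -> E i v -> sqnorm (phi i - x) = lam i v.
  move: xc; rewrite inE => /andP[-> /forallP H]; split=> // i im iv.
  by have := H i; rewrite inE im iv => /eqP.
exists phi'; split.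
- move=> i j /ltmS[->|im] /ltmS[->|jm] //; rewrite ?phi'v ?phi'E //.
  + by move=> e; case/eqP: (xU j jm).
  + by move=> e; case/eqP: (xU i im).
  + exact: inj.
- by move=> i /ltmS[->|im]; rewrite ?phi'v ?phi'E // inA.
- move=> i j /ltmS[->|im] /ltmS[->|jm]; rewrite ?phi'v ?phi'E //.
  + by rewrite (negPf (irr v)).
  + by move=> vj; rewrite sqnormBC (xd j jm) ?(lsym v j vj) // -sym.
  + exact: xd.
  + exact: dist.
move=> w mw; have mw' : (m <= w)%N by apply: ltnW.
have := cand w mw'.
have [vw|nvw] := boolP (E v w); last first.
  have nbE : placed_nbrs m.+1 w = placed_nbrs m w.
    apply/setP => i; rewrite !inE ltnS leq_eqVlt andb_orl (_ : (i == m :> nat) = (i == v)) //.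
    by case: eqP => [->|//]; rewrite (negPf nvw) andbF.
  suff -> : candidates phi' m.+1 w = candidates phi m w by rewrite nbE.
  apply/setP => y; rewrite !inE nbE; congr (_ && _); apply: eq_forallb => i.
  by rewrite inE; case: (ltnP i m) => //= im; rewrite phi'E.
have nbE : placed_nbrs m.+1 w = v |: placed_nbrs m w.
  apply/setP => i; rewrite !inE ltnS leq_eqVlt andb_orl (_ : (i == m :> nat) = (i == v)) //.
  by case: eqP => [->|//]; rewrite vw.
have vn : v \notin placed_nbrs m w by rewrite inE ltnn.
have cE : candidates phi' m.+1 w = [set y in candidates phi m w | sqnorm (x - y) == lam v w].
  apply/setP => y; rewrite !inE nbE -andbA; congr (_ && _).
  apply/forallP/andP => [H|[/forallP H xy] i].
    split; last by have := H v; rewrite !inE eqxx /= phi'v.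
    apply/forallP => i; apply/implyP => ii; have := H i; rewrite in_setU1 ii orbT /= phi'E //.
    by move: ii; rewrite inE => /andP[].
  apply/implyP; rewrite in_setU1 => /orP[/eqP ->|ii]; first by rewrite phi'v.
  by have := H i; rewrite ii phi'E //; move: ii; rewrite inE => /andP[].
have := xB w mw vw; rewrite inE xc /= -ltnNge -cE nbE cardsU1 vn add1n.
have rn : (#|placed_nbrs m w| < n)%N.
  rewrite -[X in (_ < X)%N]card_ord -cardsT; apply/proper_card/properP.
  by split; [apply: subsetT | exists v].
move: (candidates phi' _ _) => C'; set c := #|candidates _ _ _|.
set r := #|placed_nbrs m w| in rn *.
move: #|C'| => c' good old.
have n0 : (0 < n)%N by apply: leq_ltn_trans rn.
(* A good x keeps more than the fraction (2n - 1)/(2n) of |C_w| / q, and (2n - 1)(2n - r) >= 2n (2n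
   - r - 1): the linear weight absorbs one more loss. *)
rewrite expnS -(leq_pmul2l (_ : 0 < 2 * n)%N); last by rewrite muln_gt0 n0.
apply: leq_trans (_ : 2 * n * q ^ r * ((2 * n - 1) * c) <= _)%N.
  apply: leq_trans (_ : (2 * n - 1) * (#|A| * (2 * n - r)) <= _)%N.
    rewrite mulnCA [X in (_ <= X)%N]mulnCA leq_mul2l; apply/orP; right.
    have [M eM] : exists M, (2 * n = M.+1)%N by exists (2 * n - 1)%N; lia.
    have rM : (r <= M)%N by lia.
    by rewrite eM subSS subn1 [M.+1.-1]/= (subSn rM) mulSn mulnS leq_add2r leq_subr.
  by rewrite [X in (_ <= X)%N]mulnCA leq_mul2l old orbT.
apply: leq_trans (leq_mul (leqnn _) (ltnW good)) _.
move: (q ^ r)%N => y; rewrite leq_eqVlt; apply/orP; left; apply/eqP; lia.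
Qed.

Lemma isometric_copy_exists : contains_isometric_copy A E lam.
Proof.
have emb m : (m <= n)%N -> exists phi, partial_embedding m phi.
  elim: m => [_|m IHm mn]; last first.
    by have [phi embm] := IHm (ltnW mn); apply: (partial_embedding_step mn embm).
  exists (fun _ => 0); split=> // w _.
  have -> : placed_nbrs 0 w = set0 by apply/setP => i; rewrite !inE.
  have -> : candidates (fun=> 0) 0 w = A.
    apply/setP => y; rewrite inE; case: (y \in A) => //=.
    by apply/forallP => i; rewrite inE.
  by rewrite cards0 subn0 expn0 muln1 mulnC.
have [phi [inj inA dist _]] := emb n (leqnn n).
exists phi; split=> [i j|i|i j]; [apply: inj | apply: inA | apply: dist] => //.
Qed.

End Embedding.

Unset Implicit Arguments.

(* q = #|F|, odd characteristic: 2 is not the characteristic of F.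
   |A| >= 12 n^2 q^((d-1)/2 + t)  is stated in squared form
   |A|^2 >= 144 n^4 q^(d-1+2t)  (all quantities nonnegative). *)
Theorem theorem1p2 (F : finFieldType) (d n t : nat) (A : {set 'rV[F]_d}) :
  (2%N \notin [pchar F])%R ->
  (1 <= d)%N ->
  (144 * n ^ 4 * #|F| ^ (d - 1 + 2 * t) <= #|A| ^ 2)%N ->
  forall (E : rel 'I_n) (lam : 'I_n -> 'I_n -> F),
    distance_graph E lam ->
    max_degree_le E t ->
    contains_isometric_copy A E lam.
Proof.
move=> ch2 d0 cardA E lam DG degE; exact: (isometric_copy_exists ch2 d0 cardA DG degE).
Qed.
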